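(* Let $X$ be a Frobenius split scheme of prime characteristic $p$, let $\mathcal{L}$ be an invertible sheaf on $X$, and let $i$ be an integer. If $H^i(X,\mathcal{L}^n)=0$ for all $n\gg 0$, then $H^i(X,\mathcal{L})=0$.
   Context: For a scheme $X$ of prime characteristic $p$, the Frobenius map $F: X \to X$ is the identity on the underlying topological space, with the map of sheaves of rings $\mathcal{O}_X \to F_*\mathcal{O}_X$ given locally on sections by $s \mapsto s^p$. The scheme $X$ is Frobenius split if $\mathcal{O}_X \to F_*\mathcal{O}_X$ splits as a map of $\mathcal{O}_X$-modules, i.e. there is an $\mathcal{O}_X$-linear map $\phi: F_*\mathcal{O}_X \to \mathcal{O}_X$ such that the composition $\mathcal{O}_X \to F_*\mathcal{O}_X \to \mathcal{O}_X$ is the identity. $\mathcal{L}^n$ denotes the $n$-th tensor power. *)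

(* Defs.v *)
(* Rings of sections are [comPzRingType], not [comNzRingType]: the ring of
   sections over the empty set is zero. *)
From HB Require Import structures.
From mathcomp Require Import all_boot all_order all_algebra.
From mathcomp Require Import all_classical topology.
From mathcomp Require Import ring.

Set Implicit Arguments.
Unset Strict Implicit.
Unset Printing Implicit Defensive.

Import GRing.Theory.
Local Open Scope classical_set_scope.
Local Open Scope ring_scope.

Record quot (T : Type) (r : T -> T -> Prop) := Quot {
  quot_set : set T;
  quotP : exists x, quot_set = r x }.

HB.instance Definition _ T r := gen_eqMixin (@quot T r).
HB.instance Definition _ T r := gen_choiceMixin (@quot T r).

Definition cls (T : Type) (r : T -> T -> Prop) (x : T) : quot r :=
  Quot (ex_intro (fun y => r x = r y) x erefl).

Definition qrepr (T : Type) (r : T -> T -> Prop) (q : quot r) : T :=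
  projT1 (cid (quotP q)).

Record equivalence (T : Type) (r : T -> T -> Prop) : Prop := Equivalence {
  equiv_refl : forall x, r x x;
  equiv_sym : forall x y, r x y -> r y x;
  equiv_trans : forall x y z, r x y -> r y z -> r x z }.

Lemma quot_inj (T : Type) (r : T -> T -> Prop) (q q' : quot r) :
  quot_set q = quot_set q' -> q = q'.
Proof.
case: q q' => [s sP] [s' sP'] /= e; case: s' / e sP' => sP'.
by congr Quot; exact: Prop_irrelevance.
Qed.

Lemma qreprK (T : Type) (r : T -> T -> Prop) (q : quot r) : cls r (qrepr q) = q.
Proof. by apply: quot_inj; rewrite /qrepr /=; case: cid. Qed.

Lemma cls_eq (T : Type) (r : T -> T -> Prop) (e : equivalence r) (x y : T) :
  r x y -> cls r x = cls r y.
Proof.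
case: e => _ sy tr xy; apply: quot_inj => /=; apply/funext => z.
by apply/propext; split; [apply: tr; apply: sy|apply: tr].
Qed.

Lemma cls_rel (T : Type) (r : T -> T -> Prop) (e : equivalence r) (x y : T) :
  cls r x = cls r y -> r x y.
Proof. by case=> ->; apply: equiv_refl. Qed.

Lemma qrepr_rel (T : Type) (r : T -> T -> Prop) (e : equivalence r) (x : T) :
  r (qrepr (cls r x)) x.
Proof. by apply: cls_rel => //; rewrite qreprK. Qed.

Lemma quotW (T : Type) (r : T -> T -> Prop) (Q : quot r -> Prop) :
  (forall x, Q (cls r x)) -> forall q, Q q.
Proof. by move=> h q; rewrite -(qreprK q). Qed.

Record prime_ideal (A : comPzRingType) := PrimeIdeal {
  pi_set :> A -> Prop;
  pi_0 : pi_set 0;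
  pi_D : forall a b, pi_set a -> pi_set b -> pi_set (a + b);
  pi_M : forall a b, pi_set b -> pi_set (a * b);
  pi_1 : ~ pi_set 1;
  pi_prime : forall a b, pi_set (a * b) -> pi_set a \/ pi_set b }.
Arguments pi_1 {A} p.

HB.instance Definition _ A := gen_eqMixin (prime_ideal A).
HB.instance Definition _ A := gen_choiceMixin (prime_ideal A).

Section Zariski.
Variable A : comPzRingType.

(* The closed sets are the V(E) = {p | E `<=` p}. *)
Definition zariski_open : set (set (prime_ideal A)) :=
  [set U | exists E : set A, U = ~` [set p | E `<=` pi_set p]].

Lemma zariskiT : zariski_open setT.
Proof.
exists setT; apply/seteqP; split => p //= _ /(_ 1 I); exact: pi_1.
Qed.

Lemma zariskiI : setI_closed zariski_open.
Proof.
move=> _ _ [E ->] [F ->].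
exists [set a | exists2 e, E e & exists2 f, F f & a = e * f].
apply/seteqP; split => p /=.
  move=> [nE nF] h.
  have [e Ee npe] : exists2 e, E e & ~ p e.
    apply: contrapT => k; apply: nE => e Ee; apply: contrapT => npe.
    by apply: k; exists e.
  apply: nF => f Ff.
  have /(h _) : exists2 e', E e' & exists2 f', F f' & e * f = e' * f'.
    by exists e => //; exists f.
  by case/pi_prime.
move=> h; split=> k; apply: h => _ [e Ee [f Ff ->]].
  by rewrite mulrC; apply/pi_M/k.
by apply/pi_M/k.
Qed.

Lemma zariski_bigU (I : Type) (f : I -> set (prime_ideal A)) :
  (forall i, zariski_open (f i)) -> zariski_open (\bigcup_i f i).
Proof.
move=> fo; exists [set a | exists i, projT1 (cid (fo i)) a].
apply/seteqP; split => p /=.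
  move=> [i _ pi] h; have e := projT2 (cid (fo i)).
  by move: pi; rewrite e; apply => a ha; apply: h; exists i.
move=> h; apply: contrapT => k; apply: h => a [i ai].
apply: contrapT => npa; apply: k; exists i => //.
by rewrite (projT2 (cid (fo i))) => /(_ _ ai).
Qed.

HB.instance Definition _ :=
  isOpenTopological.Build (prime_ideal A) zariskiT zariskiI zariski_bigU.

End Zariski.

Section Localization.
Variables (A : comPzRingType) (p : prime_ideal A).

Record frac := Frac { fnum : A; fden : A; fdenP : ~ p fden }.
Arguments fdenP : clear implicits.

Definition frac_eq (x y : frac) : Prop :=
  exists2 u, ~ p u & u * (fnum x * fden y) = u * (fnum y * fden x).

Definition loc : Type := quot frac_eq.
HB.instance Definition _ := Choice.on loc.

Lemma pi_nM a b : ~ p a -> ~ p b -> ~ p (a * b).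
Proof. by move=> na nb /pi_prime []. Qed.

Lemma frac_equiv : equivalence frac_eq.
Proof.
split=> [x|x y [u nu e]|x y z [u nu e] [v nv f]].
- by exists 1 => //; exact: pi_1.
- by exists u.
- exists (u * v * fden y); first exact: pi_nM (pi_nM nu nv) (fdenP y).
  transitivity (v * fden z * (u * (fnum x * fden y))); first by ring.
  rewrite e; transitivity (u * fden x * (v * (fnum y * fden z))); first by ring.
  by rewrite f; ring.
Qed.

Definition mkfrac a s (ns : ~ p s) : loc := cls frac_eq (Frac a ns).

Lemma mkfrac_eq a s ns b t nt :
  a * t = b * s -> @mkfrac a s ns = @mkfrac b t nt.
Proof.
by move=> e; apply: cls_eq frac_equiv _ _ _; exists 1; rewrite ?e //; exact: pi_1.
Qed.

Lemma locW (Q : loc -> Prop) : (forall a s ns, Q (@mkfrac a s ns)) -> forall x, Q x.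
Proof. by move=> h; apply: quotW => -[a s ns]; exact: h. Qed.

Definition loc0 : loc := mkfrac 0 (pi_1 p).
Definition loc1 : loc := mkfrac 1 (pi_1 p).
Definition locN (x : loc) : loc :=
  let f := qrepr x in mkfrac (- fnum f) (fdenP f).
Definition locD (x y : loc) : loc :=
  let f := qrepr x in let g := qrepr y in
  mkfrac (fnum f * fden g + fnum g * fden f) (pi_nM (fdenP f) (fdenP g)).
Definition locM (x y : loc) : loc :=
  let f := qrepr x in let g := qrepr y in
  mkfrac (fnum f * fnum g) (pi_nM (fdenP f) (fdenP g)).

Lemma locNE a s ns : locN (@mkfrac a s ns) = mkfrac (- a) ns.
Proof.
rewrite /locN /=; have := qrepr_rel frac_equiv (Frac a ns).
rewrite -/(mkfrac a ns); case: (qrepr _) => b t nt [u nu /= e].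
by apply: cls_eq frac_equiv _ _ _; exists u => //=; rewrite !mulNr !mulrN e.
Qed.

Lemma locDE a s ns b t nt :
  locD (@mkfrac a s ns) (@mkfrac b t nt) = mkfrac (a * t + b * s) (pi_nM ns nt).
Proof.
rewrite /locD /=; have := qrepr_rel frac_equiv (Frac a ns).
rewrite -/(mkfrac a ns); case: (qrepr (mkfrac a ns)) => a' s' ns' [u nu /= e].
have := qrepr_rel frac_equiv (Frac b nt).
rewrite -/(mkfrac b nt); case: (qrepr (mkfrac b nt)) => b' t' nt' [v nv /= f].
apply: cls_eq frac_equiv _ _ _; exists (u * v) => /=; first exact: pi_nM.
transitivity (v * t * t' * (u * (a' * s)) + u * s * s' * (v * (b' * t))).
  by ring.
by rewrite e f; ring.
Qed.

Lemma locME a s ns b t nt :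
  locM (@mkfrac a s ns) (@mkfrac b t nt) = mkfrac (a * b) (pi_nM ns nt).
Proof.
rewrite /locM /=; have := qrepr_rel frac_equiv (Frac a ns).
rewrite -/(mkfrac a ns); case: (qrepr (mkfrac a ns)) => a' s' ns' [u nu /= e].
have := qrepr_rel frac_equiv (Frac b nt).
rewrite -/(mkfrac b nt); case: (qrepr (mkfrac b nt)) => b' t' nt' [v nv /= f].
apply: cls_eq frac_equiv _ _ _; exists (u * v) => /=; first exact: pi_nM.
transitivity ((u * (a' * s)) * (v * (b' * t))); first by ring.
by rewrite e f; ring.
Qed.

Lemma locDA : associative locD.
Proof.
elim/locW=> a s ns; elim/locW=> b t nt; elim/locW=> c r nr.
by rewrite !locDE; apply: mkfrac_eq; ring.
Qed.

Lemma locDC : commutative locD.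
Proof.
by elim/locW=> a s ns; elim/locW=> b t nt; rewrite !locDE; apply: mkfrac_eq; ring.
Qed.

Lemma loc0D : left_id loc0 locD.
Proof. by elim/locW=> a s ns; rewrite locDE; apply: mkfrac_eq; ring. Qed.

Lemma locND : left_inverse loc0 locN locD.
Proof. by elim/locW=> a s ns; rewrite locNE locDE; apply: mkfrac_eq; ring. Qed.

Lemma locMA : associative locM.
Proof.
elim/locW=> a s ns; elim/locW=> b t nt; elim/locW=> c r nr.
by rewrite !locME; apply: mkfrac_eq; ring.
Qed.

Lemma locMC : commutative locM.
Proof.
by elim/locW=> a s ns; elim/locW=> b t nt; rewrite !locME; apply: mkfrac_eq; ring.
Qed.

Lemma loc1M : left_id loc1 locM.
Proof. by elim/locW=> a s ns; rewrite locME; apply: mkfrac_eq; ring. Qed.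

Lemma locMDl : left_distributive locM locD.
Proof.
elim/locW=> a s ns; elim/locW=> b t nt; elim/locW=> c r nr.
by rewrite !(locDE, locME); apply: mkfrac_eq; ring.
Qed.

HB.instance Definition _ := GRing.isZmodule.Build loc locDA locDC loc0D locND.
HB.instance Definition _ :=
  GRing.Zmodule_isComPzRing.Build loc locMA locMC loc1M locMDl.

End Localization.

Record opens (X : topologicalType) := Opens {
  oset :> X -> Prop;
  opensP : open (oset : set X) }.

Definition osub (X : topologicalType) (V U : opens X) : Prop :=
  forall x, V x -> U x.

Definition opensT (X : topologicalType) : opens X := Opens (@openT X).

Definition opensI (X : topologicalType) (U V : opens X) : opens X :=
  Opens (openI (opensP U) (opensP V)).

Definition osub_refl (X : topologicalType) (U : opens X) : osub U U :=
  fun x Ux => Ux.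

Definition osub_trans (X : topologicalType) (U V W : opens X)
  (h : osub V U) (k : osub W V) : osub W U := fun x Wx => h x (k x Wx).

Definition osubIl (X : topologicalType) (U V : opens X) : osub (opensI U V) U :=
  fun x => @proj1 _ _.

Definition osubIr (X : topologicalType) (U V : opens X) : osub (opensI U V) V :=
  fun x => @proj2 _ _.

(* Requiring the sections to agree on every W contained in both members of the
   cover amounts, by functoriality, to requiring it on their intersection. *)
Definition sheaf_axiom (X : topologicalType) (F : opens X -> Type)
    (res : forall U V, osub V U -> F U -> F V) : Prop :=
  forall (U : opens X) (I : Type) (V : I -> opens X) (VU : forall i, osub (V i) U),
    (forall x, U x -> exists i, V i x) ->
  forall s : forall i, F (V i),
    (forall i j W (hi : osub W (V i)) (hj : osub W (V j)),
       res _ _ hi (s i) = res _ _ hj (s j)) ->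
  exists! t : F U, forall i, res _ _ (VU i) t = s i.

(* A class of functions x |-> f x \in G x on open sets. *)
Record local_class (X : topologicalType) (G : X -> zmodType) := LocalClass {
  lc_pred :> forall V : opens X, (forall x, V x -> G x) -> Prop;
  lc_res : forall (U V : opens X) (h : osub V U) f,
    lc_pred f -> lc_pred (fun x (Vx : V x) => f x (h x Vx));
  lc_0 : forall V : opens X, lc_pred (fun x (_ : V x) => 0);
  lc_N : forall (V : opens X) f, lc_pred f -> lc_pred (fun x (Vx : V x) => - f x Vx);
  lc_D : forall (V : opens X) f g, lc_pred f -> lc_pred g ->
    lc_pred (fun x (Vx : V x) => f x Vx + g x Vx) }.

(* The functions on U which lie in the class B near every point of U. *)
Record locfun (X : topologicalType) (G : X -> zmodType) (B : local_class G)
    (U : opens X) := LocFun {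
  locfun_fun :> forall x, U x -> G x;
  locfunP : forall x, U x -> exists (V : opens X) (h : osub V U),
    V x /\ B V (fun y Vy => locfun_fun (h y Vy)) }.
Arguments locfun_fun {X G B U} l x _ : rename.
Arguments locfunP {X G B U} l [x] _ : rename.
Arguments LocFun {X G B U} _ _.

HB.instance Definition _ X G B U := gen_eqMixin (@locfun X G B U).
HB.instance Definition _ X G B U := gen_choiceMixin (@locfun X G B U).

Section LocalFunctions.
Variables (X : topologicalType) (G : X -> zmodType) (B : local_class G).
Implicit Types U V : opens X.

Lemma locfun_irr U (f : locfun B U) x (h k : U x) : f x h = f x k.
Proof. by congr (f x _); exact: Prop_irrelevance. Qed.

Lemma locfun_ext U (f g : locfun B U) : (forall x Ux, f x Ux = g x Ux) -> f = g.
Proof.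
case: f g => [f fP] [g gP] /= e.
have {}e : f = g by apply: functional_extensionality_dep => x; apply/funext => Ux.
by case: g / e gP => gP; congr LocFun; exact: Prop_irrelevance.
Qed.

Lemma locfun_res_subproof U V (h : osub V U) (f : locfun B U) x : V x ->
  exists (W : opens X) (k : osub W V),
    W x /\ B W (fun y Wy => f y (h y (k y Wy))).
Proof.
move=> Vx; have [W [k [Wx BW]]] := locfunP f (h x Vx).
exists (opensI W V), (@osubIr _ W V); split=> //.
suff -> : (fun y Wy => f y (h y (osubIr Wy))) =
    (fun y (Wy : opensI W V y) => f y (k y (osubIl Wy))) by exact: lc_res BW.
apply: functional_extensionality_dep => y; apply/funext => Wy.
exact: locfun_irr.
Qed.

Definition locfun_res U V (h : osub V U) (f : locfun B U) : locfun B V :=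
  LocFun (fun x Vx => f x (h x Vx)) (@locfun_res_subproof U V h f).

Lemma locfun_sheaf : sheaf_axiom locfun_res.
Proof.
move=> U I V VU cov s sE.
pose c x (Ux : U x) := cid (cov x Ux).
pose t x (Ux : U x) : G x := s (projT1 (c x Ux)) x (projT2 (c x Ux)).
have tE i x (Vx : V i x) (Ux : U x) : t x Ux = s i x Vx.
  rewrite /t; case: (c x Ux) => j Vjx /=.
  have hx : opensI (V j) (V i) x by split.
  have := sE j i _ (@osubIl _ (V j) (V i)) (@osubIr _ (V j) (V i)).
  move/(congr1 (fun f => locfun_fun f x hx)) => /= e.
  apply: etrans (locfun_irr (s j) _ (osubIl hx)) _.
  exact: etrans e (locfun_irr (s i) (osubIr hx) Vx).
have tP x : U x -> exists (W : opens X) (h : osub W U),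
    W x /\ B W (fun y Wy => t y (h y Wy)).
  move=> Ux; have [i Vx] := cov x Ux.
  have [W [k [Wx BW]]] := locfunP (s i) Vx.
  exists W, (osub_trans (VU i) k); split=> //.
  suff -> : (fun y Wy => t y (osub_trans (VU i) k Wy)) =
     (fun y (Wy : W y) => s i y (k y Wy)) by [].
  apply: functional_extensionality_dep => y; apply/funext => Wy; exact: tE.
exists (LocFun t tP); split.
  by move=> i; apply: locfun_ext => x Vx; exact: tE.
move=> t' t'E; apply: locfun_ext => x Ux /=; have [i Vx] := cov x Ux.
rewrite (tE i x Vx) -(t'E i) /=; exact: locfun_irr.
Qed.

Lemma locfun2P U (f g : locfun B U) x : U x ->
  exists (V : opens X) (h : osub V U),
    [/\ V x, B V (fun y Vy => f y (h y Vy)) & B V (fun y Vy => g y (h y Vy))].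
Proof.
move=> Ux; have [V [h [Vx Bf]]] := locfunP f Ux.
have [W [k [Wx Bg]]] := locfunP (locfun_res h g) Vx.
exists W, (osub_trans h k); split=> //; first exact: (@lc_res _ _ B _ _ k _ Bf).
Qed.

Lemma locfun0_subproof U x : U x -> exists (V : opens X) (h : osub V U),
  V x /\ B V (fun y _ => 0).
Proof. by move=> Ux; exists U, (@osub_refl _ U); split=> //; exact: lc_0. Qed.

Lemma locfunN_subproof U (f : locfun B U) x : U x ->
  exists (V : opens X) (h : osub V U), V x /\ B V (fun y Vy => - f y (h y Vy)).
Proof.
move=> Ux; have [V [h [Vx Bf]]] := locfunP f Ux; exists V, h; split=> //.
exact: lc_N Bf.
Qed.

Lemma locfunD_subproof U (f g : locfun B U) x : U x ->
  exists (V : opens X) (h : osub V U),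
    V x /\ B V (fun y Vy => f y (h y Vy) + g y (h y Vy)).
Proof.
move=> Ux; have [V [h [Vx Bf Bg]]] := locfun2P f g Ux.
by exists V, h; split=> //; exact: lc_D Bf Bg.
Qed.

Definition locfun0 U : locfun B U := LocFun (fun _ _ => 0) (@locfun0_subproof U).
Definition locfunN U (f : locfun B U) : locfun B U := 
  LocFun (fun x Ux => - f x Ux) (@locfunN_subproof U f).
Definition locfunD U (f g : locfun B U) : locfun B U := 
  LocFun (fun x Ux => f x Ux + g x Ux) (@locfunD_subproof U f g).

Lemma locfunDA U : associative (@locfunD U).
Proof. by move=> f g h; apply: locfun_ext => x Ux /=; rewrite addrA. Qed.
Lemma locfunDC U : commutative (@locfunD U).
Proof. by move=> f g; apply: locfun_ext => x Ux /=; rewrite addrC. Qed.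
Lemma locfun0D U : left_id (locfun0 U) (@locfunD U).
Proof. by move=> f; apply: locfun_ext => x Ux /=; rewrite add0r. Qed.
Lemma locfunND U : left_inverse (locfun0 U) (@locfunN U) (@locfunD U).
Proof. by move=> f; apply: locfun_ext => x Ux /=; rewrite addNr. Qed.

HB.instance Definition _ U := GRing.isZmodule.Build (locfun B U)
  (@locfunDA U) (@locfunDC U) (@locfun0D U) (@locfunND U).

End LocalFunctions.

Record ringed_space := RingedSpace {
  rs_space :> topologicalType;
  rs_sec : opens rs_space -> comPzRingType;
  rs_res : forall U V, osub V U -> {rmorphism rs_sec U -> rs_sec V};
  rs_res_id : forall U (h : osub U U) s, rs_res h s = s;
  rs_res_comp : forall U V W (h : osub V U) (k : osub W V) (l : osub W U) s,
    rs_res k (rs_res h s) = rs_res l s;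
  rs_sheaf : sheaf_axiom (fun U V h => rs_res h : rs_sec U -> rs_sec V) }.

Section StructureSheaf.
Variable A : comPzRingType.
Implicit Types U V : opens (prime_ideal A).

Definition loc_zmod (p : prime_ideal A) : zmodType := loc p.

(* The functions p |-> a / s, with s in no p \in V. *)
Definition is_fraction V (f : forall p, V p -> loc_zmod p) : Prop :=
  exists a s, forall p (Vp : V p), exists ns : ~ p s, f p Vp = mkfrac a ns.

Lemma is_fraction_res U V (h : osub V U) f :
  is_fraction f -> is_fraction (fun p (Vp : V p) => f p (h p Vp)).
Proof. by move=> [a [s as_]]; exists a, s => p Vp; exact: as_. Qed.

Lemma is_fraction0 V : is_fraction (fun p (_ : V p) => 0).
Proof. by exists 0, 1 => p Vp; exists (pi_1 p). Qed.

Lemma is_fraction1 V : is_fraction (fun p (_ : V p) => (1 : loc p)).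
Proof. by exists 1, 1 => p Vp; exists (pi_1 p). Qed.

Lemma is_fractionN V f :
  is_fraction f -> is_fraction (fun p (Vp : V p) => - f p Vp).
Proof.
move=> [a [s as_]]; exists (- a), s => p Vp; have [ns ->] := as_ p Vp.
by exists ns; exact: locNE.
Qed.

Lemma is_fractionD V f g : is_fraction f -> is_fraction g ->
  is_fraction (fun p (Vp : V p) => f p Vp + g p Vp).
Proof.
move=> [a [s as_]] [b [t bt]]; exists (a * t + b * s), (s * t) => p Vp.
have [ns ->] := as_ p Vp; have [nt ->] := bt p Vp.
by exists (pi_nM ns nt); exact: locDE.
Qed.

Lemma is_fractionM V (f g : forall p, V p -> loc p) :
  is_fraction f -> is_fraction g ->
  is_fraction (fun p (Vp : V p) => f p Vp * g p Vp).
Proof.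
move=> [a [s as_]] [b [t bt]]; exists (a * b), (s * t) => p Vp.
have [ns ->] := as_ p Vp; have [nt ->] := bt p Vp.
by exists (pi_nM ns nt); exact: locME.
Qed.

Definition fraction_class : local_class loc_zmod :=
  LocalClass is_fraction_res is_fraction0 is_fractionN is_fractionD.

Definition spec_sec U : Type := locfun fraction_class U.
HB.instance Definition _ U := GRing.Zmodule.on (spec_sec U).

Lemma spec1_subproof U p : U p -> exists (V : opens (prime_ideal A)) (h : osub V U),
  V p /\ fraction_class V (fun q _ => (1 : loc q)).
Proof. by move=> Up; exists U, (@osub_refl _ U); split=> //; exact: is_fraction1. Qed.

Lemma specM_subproof U (f g : spec_sec U) p : U p ->
  exists (V : opens (prime_ideal A)) (h : osub V U),
    V p /\ fraction_class V
      (fun q Vq => (f q (h q Vq) : loc q) * (g q (h q Vq) : loc q)).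
Proof.
move=> Up; have [V [h [Vp Bf Bg]]] := locfun2P f g Up.
by exists V, h; split=> //; exact: is_fractionM Bf Bg.
Qed.

Definition spec1 U : spec_sec U :=
  LocFun (fun p _ => (1 : loc p)) (@spec1_subproof U).
Definition specM U (f g : spec_sec U) : spec_sec U :=
  LocFun (fun p Up => (f p Up : loc p) * (g p Up : loc p)) (@specM_subproof U f g).

Lemma specMA U : associative (@specM U).
Proof. by move=> f g h; apply: locfun_ext => p Up; exact: mulrA. Qed.
Lemma specMC U : commutative (@specM U).
Proof. by move=> f g; apply: locfun_ext => p Up; exact: mulrC. Qed.
Lemma spec1M U : left_id (spec1 U) (@specM U).
Proof. by move=> f; apply: locfun_ext => p Up; exact: mul1r. Qed.
Lemma specMDl U : left_distributive (@specM U) +%R.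
Proof. by move=> f g h; apply: locfun_ext => p Up; exact: mulrDl. Qed.

HB.instance Definition _ U := GRing.Zmodule_isComPzRing.Build (spec_sec U)
  (@specMA U) (@specMC U) (@spec1M U) (@specMDl U).

Definition spec_res U V (h : osub V U) : spec_sec U -> spec_sec V :=
  locfun_res h.

Lemma spec_res_zmod U V (h : osub V U) : zmod_morphism (spec_res h).
Proof. by move=> f g; apply: locfun_ext. Qed.

Lemma spec_res_monoid U V (h : osub V U) : monoid_morphism (spec_res h).
Proof. by split=> [|f g]; apply: locfun_ext. Qed.

HB.instance Definition _ U V (h : osub V U) :=
  GRing.isZmodMorphism.Build _ _ (spec_res h) (spec_res_zmod h).
HB.instance Definition _ U V (h : osub V U) :=
  GRing.isMonoidMorphism.Build _ _ (spec_res h) (spec_res_monoid h).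

Lemma spec_res_id U (h : osub U U) (f : spec_sec U) : spec_res h f = f.
Proof.
by apply: locfun_ext => p Up /=; exact: locfun_irr.
Qed.

Lemma spec_res_comp U V W (h : osub V U) (k : osub W V) (l : osub W U)
  (f : spec_sec U) : spec_res k (spec_res h f) = spec_res l f.
Proof.
by apply: locfun_ext => p Up /=; exact: locfun_irr.
Qed.

Definition Spec : ringed_space :=
  @RingedSpace (prime_ideal A) (fun U => spec_sec U) (fun U V h => spec_res h)
    spec_res_id spec_res_comp (@locfun_sheaf _ _ fraction_class).

End StructureSheaf.

(* The ringed space Y is isomorphic to the open subspace oi_fun(Y) of X; ring
   maps go from the sections over the image of V to the sections over V. *)
Record open_immersion (Y X : ringed_space) := OpenImmersion {
  oi_fun :> Y -> X;
  oi_continuous : continuous oi_fun;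
  oi_inj : injective oi_fun;
  oi_open : forall V : opens Y, open (oi_fun @` (V : set Y));
  oi_image := fun V : opens Y => Opens (oi_open V);
  oi_comorph : forall V : opens Y, {rmorphism rs_sec (oi_image V) -> rs_sec V};
  oi_comorph_bij : forall V, bijective (@oi_comorph V);
  oi_comorph_res : forall (U V : opens Y) (h : osub V U)
      (k : osub (oi_image V) (oi_image U)) s,
    oi_comorph V (rs_res k s) = rs_res h (oi_comorph U s) }.

(* Ringed spaces suffice here: an isomorphism of ringed spaces induces
   isomorphisms of stalks, so those of a space locally isomorphic to affine
   schemes are local rings, and the isomorphisms are of locally ringed spaces. *)
Definition is_scheme (X : ringed_space) : Prop :=
  forall x : X, exists (A : comPzRingType) (j : open_immersion (Spec A) X),
    exists p, j p = x.

Record scheme := Scheme {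
  scheme_rs :> ringed_space;
  schemeP : is_scheme scheme_rs }.

Record presheaf (X : topologicalType) := Presheaf {
  ps_sec :> opens X -> zmodType;
  ps_res : forall U V, osub V U -> {additive ps_sec U -> ps_sec V};
  ps_res_id : forall U (h : osub U U) s, ps_res h s = s;
  ps_res_comp : forall U V W (h : osub V U) (k : osub W V) (l : osub W U) s,
    ps_res k (ps_res h s) = ps_res l s }.
Arguments ps_res {X p U V} h.

Record sheaf (X : topologicalType) := Sheaf {
  sh_presheaf :> presheaf X;
  sheafP : sheaf_axiom (fun U V h => ps_res h : sh_presheaf U -> sh_presheaf V) }.

Record ab_hom (X : topologicalType) (F G : presheaf X) := AbHom {
  ab_hom_fun :> forall U, {additive F U -> G U};
  ab_hom_res : forall U V (h : osub V U) s,
    ps_res h (ab_hom_fun U s) = ab_hom_fun V (ps_res h s) }.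

Section Stalk.
Variables (X : topologicalType) (F : presheaf X) (x : X).

Record local_section := LocalSection {
  ls_dom : opens X;
  ls_mem : ls_dom x;
  ls_sec : F ls_dom }.

Definition germ_eq (s t : local_section) : Prop :=
  exists (W : opens X) (h : osub W (ls_dom s)) (k : osub W (ls_dom t)),
    W x /\ ps_res h (ls_sec s) = ps_res k (ls_sec t).

Definition stalk : Type := quot germ_eq.
HB.instance Definition _ := Choice.on stalk.

Lemma germ_equiv : equivalence germ_eq.
Proof.
split=> [s|s t [W [h [k [Wx e]]]]|s t r [W [h [k [Wx e]]]] [W' [h' [k' [Wx' e']]]]].
- by exists (ls_dom s), (@osub_refl _ _), (@osub_refl _ _); split=> //; exact: ls_mem.
- by exists W, k, h.
exists (opensI W W'), (osub_trans h (@osubIl _ _ _)), (osub_trans k' (@osubIr _ _ _)).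
split=> //.
rewrite -(ps_res_comp h (@osubIl _ W W')) e -(ps_res_comp k' (@osubIr _ W W')) -e'.
rewrite (ps_res_comp _ _ (osub_trans k (@osubIl _ W W'))).
by rewrite (ps_res_comp _ _ (osub_trans k (@osubIl _ W W'))).
Qed.

Definition germ (U : opens X) (Ux : U x) (s : F U) : stalk :=
  cls germ_eq (LocalSection Ux s).

Lemma germ_res (U V : opens X) (h : osub V U) (Ux : U x) (Vx : V x) s :
  germ Vx (ps_res h s) = germ Ux s.
Proof.
apply: cls_eq germ_equiv _ _ _; exists V, (@osub_refl _ V), h; split=> //=.
exact: ps_res_id.
Qed.

Lemma germ_eqP (U V : opens X) (Ux : U x) (Vx : V x) s t :
  germ Ux s = germ Vx t ->
  exists (W : opens X) (h : osub W U) (k : osub W V),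
    W x /\ ps_res h s = ps_res k t.
Proof. by move/(cls_rel germ_equiv). Qed.

Lemma stalkW (Q : stalk -> Prop) :
  (forall (U : opens X) (Ux : U x) s, Q (germ Ux s)) -> forall z, Q z.
Proof. by move=> h z; rewrite -(qreprK z); case: (qrepr z) => U Ux s; exact: h. Qed.

Lemma stalk2W (Q : stalk -> stalk -> Prop) :
  (forall (U : opens X) (Ux : U x) s t, Q (germ Ux s) (germ Ux t)) -> forall z w, Q z w.
Proof.
move=> h; elim/stalkW=> U Ux s; elim/stalkW=> V Vx t.
have hx : opensI U V x by split.
by rewrite -(germ_res (@osubIl _ U V) Ux hx) -(germ_res (@osubIr _ U V) Vx hx).
Qed.

Lemma stalk3W (Q : stalk -> stalk -> stalk -> Prop) :
  (forall (U : opens X) (Ux : U x) s t r, Q (germ Ux s) (germ Ux t) (germ Ux r)) ->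
  forall z w v, Q z w v.
Proof.
move=> h; apply: (stalk2W (Q := fun z w => forall v, Q z w v)) => U Ux s t.
elim/stalkW=> V Vx r.
have hx : opensI U V x by split.
rewrite -!(germ_res (@osubIl _ U V) Ux hx) -(germ_res (@osubIr _ U V) Vx hx).
exact: h.
Qed.

Definition stalk0 : stalk := @germ (opensT X) I 0.
Definition stalkN (z : stalk) : stalk :=
  let s := qrepr z in germ (ls_mem s) (- ls_sec s).
Definition stalkD (z w : stalk) : stalk :=
  let s := qrepr z in let t := qrepr w in
  @germ (opensI (ls_dom s) (ls_dom t)) (conj (ls_mem s) (ls_mem t))
    (ps_res (@osubIl _ _ _) (ls_sec s) + ps_res (@osubIr _ _ _) (ls_sec t)).

Lemma stalk0E (U : opens X) (Ux : U x) : stalk0 = germ Ux 0.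
Proof.
by rewrite /stalk0 -(@germ_res (opensT X) U (fun _ _ => I) I Ux) raddf0.
Qed.

Lemma stalkNE (U : opens X) (Ux : U x) s : stalkN (germ Ux s) = germ Ux (- s).
Proof.
rewrite /stalkN /=; have := qrepr_rel germ_equiv (LocalSection Ux s).
rewrite -/(germ Ux s); case: (qrepr _) => V Vx t [W [h [k [Wx /= e]]]].
by rewrite -(germ_res h Vx Wx) raddfN /= e -raddfN germ_res.
Qed.

Lemma stalkDE (U : opens X) (Ux : U x) s t :
  stalkD (germ Ux s) (germ Ux t) = germ Ux (s + t).
Proof.
rewrite /stalkD /=; have := qrepr_rel germ_equiv (LocalSection Ux s).
rewrite -/(germ Ux s); case: (qrepr (germ Ux s)) => V Vx s' [W [h [k [Wx /= e]]]].
have := qrepr_rel germ_equiv (LocalSection Ux t).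
rewrite -/(germ Ux t); case: (qrepr (germ Ux t)) => V' Vx' t' [W' [h' [k' [Wx' /= e']]]].
have hx : opensI W W' x by split.
have hh : osub (opensI W W') (opensI V V') by move=> y [/h + /h'].
rewrite -(germ_res hh _ hx) raddfD /=.
rewrite (ps_res_comp _ _ (osub_trans h (@osubIl _ W W'))).
rewrite (ps_res_comp _ _ (osub_trans h' (@osubIr _ W W'))).
rewrite -(ps_res_comp h (@osubIl _ W W')) e -(ps_res_comp h' (@osubIr _ W W')) e'.
rewrite (ps_res_comp _ _ (osub_trans k (@osubIl _ W W'))).
by rewrite (ps_res_comp _ _ (osub_trans k (@osubIl _ W W'))) -raddfD germ_res.
Qed.

Lemma stalkDA : associative stalkD.
Proof. by apply: stalk3W => U Ux s t r; rewrite !stalkDE addrA. Qed.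
Lemma stalkDC : commutative stalkD.
Proof. by apply: stalk2W => U Ux s t; rewrite !stalkDE addrC. Qed.
Lemma stalk0D : left_id stalk0 stalkD.
Proof. by elim/stalkW=> U Ux s; rewrite (stalk0E Ux) stalkDE add0r. Qed.
Lemma stalkND : left_inverse stalk0 stalkN stalkD.
Proof. by elim/stalkW=> U Ux s; rewrite (stalk0E Ux) stalkNE stalkDE addNr. Qed.

HB.instance Definition _ := GRing.isZmodule.Build stalk
  stalkDA stalkDC stalk0D stalkND.

End Stalk.

Record premod (X : ringed_space) := Premod {
  pm_sec : forall U : opens X, lmodType (rs_sec U);
  pm_res : forall U V, osub V U -> {additive pm_sec U -> pm_sec V};
  pm_res_id : forall U (h : osub U U) s, pm_res h s = s;
  pm_res_comp : forall U V W (h : osub V U) (k : osub W V) (l : osub W U) s,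
    pm_res k (pm_res h s) = pm_res l s;
  pm_resZ : forall U V (h : osub V U) a s,
    pm_res h (a *: s) = rs_res h a *: pm_res h s }.
Arguments pm_res {X p U V} h.

Definition premod_presheaf (X : ringed_space) (M : premod X) : presheaf X :=
  @Presheaf X (fun U => pm_sec M U) (@pm_res X M) (@pm_res_id X M) (@pm_res_comp X M).
Coercion premod_presheaf : premod >-> presheaf.

Record smod (X : ringed_space) := Smod {
  sm_premod :> premod X;
  smodP : sheaf_axiom (fun U V h => pm_res h : pm_sec sm_premod U -> pm_sec sm_premod V) }.

Definition smod_sheaf (X : ringed_space) (M : smod X) : sheaf X :=
  @Sheaf X M (@smodP X M).
Coercion smod_sheaf : smod >-> sheaf.

Record mhom (X : ringed_space) (M N : premod X) := Mhom {
  mhom_fun :> forall U, {linear pm_sec M U -> pm_sec N U};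
  mhom_res : forall U V (h : osub V U) s,
    pm_res h (mhom_fun U s) = mhom_fun V (pm_res h s) }.

Section Sheafification.
Variables (X : ringed_space) (P : premod X).
Implicit Types U V W : opens X.

Lemma pm_resE U V (h : osub V U) (s : pm_sec P U) :
  pm_res h s = ps_res (p := P) h s.
Proof. by []. Qed.

(* The action of a \in O(U) on the stalk of P at a point of U. *)
Definition stalk_scale U (a : rs_sec U) x (Ux : U x) (z : stalk P x) : stalk P x :=
  let s := qrepr z in
  @germ X P x (opensI U (ls_dom s)) (conj Ux (ls_mem s))
    (rs_res (@osubIl _ _ _) a *: pm_res (@osubIr _ _ _) (ls_sec s : pm_sec P _)).

Lemma stalk_scaleE U (a : rs_sec U) x (Ux : U x) V (h : osub V U) (Vx : V x)
    (s : pm_sec P V) :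
  stalk_scale a Ux (@germ X P x V Vx s) = @germ X P x V Vx (rs_res h a *: s).
Proof.
rewrite /stalk_scale /=; have := qrepr_rel (germ_equiv P x) (LocalSection (F := P) Vx s).
rewrite -/(@germ X P x V Vx s); case: (qrepr _) => V' Vx' t [W [k [l [Wx /= e]]]].
have hh : osub W (opensI U V') by move=> y Wy; split; [exact: h (l _ _)|exact: (k y Wy)].
rewrite -(germ_res hh _ Wx) -(germ_res l Vx Wx) /= !pm_resZ.
congr germ; congr (_ *: _).
  by rewrite (rs_res_comp _ _ (osub_trans h l)) (rs_res_comp _ _ (osub_trans h l)).
by rewrite (pm_res_comp _ _ k).
Qed.

Definition is_germ V (f : forall x, V x -> stalk P x) : Prop :=
  exists s : pm_sec P V, forall x (Vx : V x), f x Vx = @germ X P x V Vx s.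

Lemma is_germ_res U V (h : osub V U) f :
  is_germ f -> is_germ (fun x (Vx : V x) => f x (h x Vx)).
Proof.
move=> [s fs]; exists (pm_res h s) => x Vx.
by rewrite fs -(germ_res (F := P) h _ Vx).
Qed.

Lemma is_germ0 V : is_germ (fun x (_ : V x) => 0).
Proof. by exists 0 => x Vx; exact: (stalk0E P Vx). Qed.

Lemma is_germN V f : is_germ f -> is_germ (fun x (Vx : V x) => - f x Vx).
Proof. by move=> [s fs]; exists (- s) => x Vx; rewrite fs; exact: stalkNE. Qed.

Lemma is_germD V f g : is_germ f -> is_germ g ->
  is_germ (fun x (Vx : V x) => f x Vx + g x Vx).
Proof.
move=> [s fs] [t gt]; exists (s + t) => x Vx; rewrite fs gt; exact: stalkDE.
Qed.

Definition germ_class : local_class (fun x => stalk P x : zmodType) :=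
  LocalClass is_germ_res is_germ0 is_germN is_germD.

Definition shf_sec U : Type := locfun germ_class U.
HB.instance Definition _ U := GRing.Zmodule.on (shf_sec U).

Lemma shfZ_subproof U (a : rs_sec U) (f : locfun germ_class U) x : U x ->
  exists (V : opens X) (h : osub V U),
    V x /\ germ_class V (fun y Vy => stalk_scale a (h y Vy) (f y (h y Vy))).
Proof.
move=> Ux; have [V [h [Vx [s fs]]]] := locfunP f Ux; exists V, h; split=> //.
by exists (rs_res h a *: s) => y Vy; rewrite fs (stalk_scaleE _ _ h).
Qed.

Definition shfZ U (a : rs_sec U) (f : locfun germ_class U) : shf_sec U :=
  LocFun (fun x Ux => stalk_scale a Ux (f x Ux)) (@shfZ_subproof U a f).

Lemma stalk_inW U x (Ux : U x) (Q : stalk P x -> Prop) :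
  (forall V (h : osub V U) (Vx : V x) (s : pm_sec P V), Q (@germ X P x V Vx s)) ->
  forall z, Q z.
Proof.
move=> hQ; elim/stalkW=> V Vx s; have hx : opensI U V x by split.
by rewrite -(germ_res (@osubIr _ U V) Vx hx); apply: (hQ _ (@osubIl _ _ _)).
Qed.

Lemma shfZA U (a b : rs_sec U) (f : locfun germ_class U) : shfZ a (shfZ b f) = shfZ (a * b) f.
Proof.
apply: locfun_ext => x Ux /=; elim/(stalk_inW Ux): (locfun_fun f x Ux) => V h Vx s.
by rewrite !(stalk_scaleE _ _ h) scalerA rmorphM.
Qed.

Lemma shf1Z U (f : locfun germ_class U) : shfZ 1 f = f.
Proof.
apply: locfun_ext => x Ux /=; elim/(stalk_inW Ux): (locfun_fun f x Ux) => V h Vx s.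
by rewrite (stalk_scaleE _ _ h) rmorph1 scale1r.
Qed.

Lemma shfZDr U : right_distributive (@shfZ U) +%R.
Proof.
move=> a f g; apply: locfun_ext => x Ux /=.
move: (locfun_fun f x Ux) (locfun_fun g x Ux); apply: stalk2W => V Vx s t.
have hx : opensI U V x by split.
rewrite -!(germ_res (F := P) (@osubIr _ U V) Vx hx).
rewrite [X in stalk_scale _ _ X]stalkDE !(stalk_scaleE _ _ (@osubIl _ U V)).
by rewrite scalerDr -stalkDE.
Qed.

Lemma shfZDl U (f : locfun germ_class U) : {morph (@shfZ U)^~ f : a b / a + b}.
Proof.
move=> a b; apply: locfun_ext => x Ux /=.
elim/(stalk_inW Ux): (locfun_fun f x Ux) => V h Vx s.
by rewrite !(stalk_scaleE _ _ h) rmorphD scalerDl -stalkDE.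
Qed.

HB.instance Definition _ U :=
  GRing.Zmodule_isLmodule.Build (rs_sec U) (shf_sec U)
    (@shfZA U) (@shf1Z U) (@shfZDr U) (@shfZDl U).

Definition shf_res U V (h : osub V U) : shf_sec U -> shf_sec V := locfun_res h.

Lemma shf_res_zmod U V (h : osub V U) : zmod_morphism (shf_res h).
Proof. by move=> f g; apply: locfun_ext. Qed.

HB.instance Definition _ U V (h : osub V U) :=
  GRing.isZmodMorphism.Build _ _ (shf_res h) (shf_res_zmod h).

Lemma shf_res_id U (h : osub U U) (f : shf_sec U) : shf_res h f = f.
Proof. by apply: locfun_ext => p Up /=; exact: locfun_irr. Qed.

Lemma shf_res_comp U V W (h : osub V U) (k : osub W V) (l : osub W U)
  (f : shf_sec U) : shf_res k (shf_res h f) = shf_res l f.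
Proof. by apply: locfun_ext => p Up /=; exact: locfun_irr. Qed.

Lemma shf_resZ U V (h : osub V U) (a : rs_sec U) (f : shf_sec U) :
  shf_res h (a *: f) = rs_res h a *: shf_res h f.
Proof.
apply: locfun_ext => x Vx /=; elim/(stalk_inW Vx): (locfun_fun f x (h x Vx)) => W k Wx s.
rewrite (stalk_scaleE _ _ (osub_trans h k)) (stalk_scaleE _ _ k).
by rewrite (rs_res_comp _ _ (osub_trans h k)).
Qed.

Definition sheafify : smod X :=
  @Smod X (@Premod X (fun U => shf_sec U) (fun U V h => shf_res h)
    shf_res_id shf_res_comp shf_resZ) (@locfun_sheaf _ _ germ_class).

End Sheafification.

Section Tensor.
Variables (R : comPzRingType) (M N : lmodType R).

(* A list of pairs (m, n) stands for the formal sum of the m \otimes n. *)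
Inductive tensor_eq : seq (M * N) -> seq (M * N) -> Prop :=
| tensor_refl s : tensor_eq s s
| tensor_sym s t : tensor_eq s t -> tensor_eq t s
| tensor_trans s t r : tensor_eq s t -> tensor_eq t r -> tensor_eq s r
| tensor_cat s s' t t' :
    tensor_eq s s' -> tensor_eq t t' -> tensor_eq (s ++ t) (s' ++ t')
| tensor_catC s t : tensor_eq (s ++ t) (t ++ s)
| tensor_0 n : tensor_eq [:: (0, n)] [::]
| tensor_Dl m m' n : tensor_eq [:: (m + m', n)] [:: (m, n); (m', n)]
| tensor_Dr m n n' : tensor_eq [:: (m, n + n')] [:: (m, n); (m, n')]
| tensor_Z a m n : tensor_eq [:: (a *: m, n)] [:: (m, a *: n)].

Definition tensor : Type := quot tensor_eq.
HB.instance Definition _ := Choice.on tensor.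

Lemma tensor_equiv : equivalence tensor_eq.
Proof. split; [exact: tensor_refl|exact: tensor_sym|exact: tensor_trans]. Qed.

Definition tens (s : seq (M * N)) : tensor := cls tensor_eq s.

Lemma tensW (Q : tensor -> Prop) : (forall s, Q (tens s)) -> forall z, Q z.
Proof. by move=> h z; rewrite -(qreprK z); exact: h. Qed.

Lemma tens_eq s t : tensor_eq s t -> tens s = tens t.
Proof. exact: (cls_eq tensor_equiv). Qed.

Definition scale_seq (a : R) (s : seq (M * N)) : seq (M * N) :=
  [seq (a *: mn.1, mn.2) | mn <- s].

Lemma scale_seq_eq a s t : tensor_eq s t -> tensor_eq (scale_seq a s) (scale_seq a t).
Proof.
elim=> {s t} /=.
- by move=> s; exact: tensor_refl.
- by move=> s t _; exact: tensor_sym.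
- by move=> s t r _ st _; exact: tensor_trans.
- by move=> s s' t t' _ ss' _ tt'; rewrite /scale_seq !map_cat; exact: tensor_cat.
- by move=> s t; rewrite /scale_seq !map_cat; exact: tensor_catC.
- by move=> n; rewrite scaler0; exact: tensor_0.
- by move=> m m' n; rewrite scalerDr; exact: tensor_Dl.
- by move=> m n n'; exact: tensor_Dr.
- by move=> b m n; rewrite scalerA mulrC -scalerA; exact: tensor_Z.
Qed.

Definition tensorD (z w : tensor) : tensor := tens (qrepr z ++ qrepr w).
Definition tensorZ (a : R) (z : tensor) : tensor := tens (scale_seq a (qrepr z)).
Definition tensorN (z : tensor) : tensor := tensorZ (-1) z.

Lemma tensorDE s t : tensorD (tens s) (tens t) = tens (s ++ t).
Proof. by apply: tens_eq; apply: tensor_cat; exact: qrepr_rel tensor_equiv _. Qed.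

Lemma tensorZE a s : tensorZ a (tens s) = tens (scale_seq a s).
Proof. by apply: tens_eq; apply: scale_seq_eq; exact: qrepr_rel tensor_equiv _. Qed.

Lemma tensorDA : associative tensorD.
Proof. by elim/tensW=> s; elim/tensW=> t; elim/tensW=> r; rewrite !tensorDE catA. Qed.

Lemma tensorDC : commutative tensorD.
Proof.
by elim/tensW=> s; elim/tensW=> t; rewrite !tensorDE; exact: tens_eq (tensor_catC _ _).
Qed.

Lemma tensor0D : left_id (tens [::]) tensorD.
Proof. by elim/tensW=> s; rewrite tensorDE. Qed.

Lemma scale_seqDl a b s :
  tensor_eq (scale_seq (a + b) s) (scale_seq a s ++ scale_seq b s).
Proof.
elim: s => [|[m n] s IHs] /=; first exact: tensor_refl.
rewrite scalerDl -cat1s.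
apply: tensor_trans (tensor_cat (tensor_Dl _ _ _) IHs) _.
have := tensor_cat (tensor_catC [:: (b *: m, n)] (scale_seq a s))
  (tensor_refl (scale_seq b s)).
by rewrite -!catA; exact: tensor_cat (tensor_refl [:: (a *: m, n)]).
Qed.

Lemma scale0_seq s : tensor_eq (scale_seq 0 s) [::].
Proof.
elim: s => [|[m n] s IHs] /=; first exact: tensor_refl.
by rewrite scale0r -cat1s; exact: (tensor_cat (tensor_0 _) IHs).
Qed.

Lemma tensorZDl z : {morph tensorZ^~ z : a b / a + b >-> tensorD a b}.
Proof.
move=> a b; elim/tensW: z => s; rewrite !tensorZE tensorDE.
exact: tens_eq (scale_seqDl _ _ _).
Qed.

Lemma tensor1Z : left_id 1 tensorZ.
Proof.
elim/tensW=> s; rewrite tensorZE; congr tens.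
by elim: s => [|[m n] s IHs] //=; rewrite scale1r IHs.
Qed.

Lemma tensorND : left_inverse (tens [::]) tensorN tensorD.
Proof.
move=> z; rewrite -{2}(tensor1Z z) -tensorZDl addNr.
by elim/tensW: z => s; rewrite tensorZE; exact: tens_eq (scale0_seq _).
Qed.

HB.instance Definition _ := GRing.isZmodule.Build tensor
  tensorDA tensorDC tensor0D tensorND.

Lemma tensD s t : tens s + tens t = tens (s ++ t).
Proof. exact: tensorDE. Qed.

Lemma tensorZA a b z : tensorZ a (tensorZ b z) = tensorZ (a * b) z.
Proof.
elim/tensW: z => s; rewrite !tensorZE; congr tens.
by elim: s => [|[m n] s IHs] //=; rewrite scalerA IHs.
Qed.

Lemma tensorZDr : right_distributive tensorZ +%R.
Proof.
move=> a; elim/tensW=> s; elim/tensW=> t.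
by rewrite !(tensD, tensorZE) /scale_seq map_cat.
Qed.

HB.instance Definition _ := GRing.Zmodule_isLmodule.Build R tensor
  tensorZA tensor1Z tensorZDr tensorZDl.

Lemma tensZ a s : a *: tens s = tens (scale_seq a s).
Proof. exact: tensorZE. Qed.

End Tensor.

Section PresheafTensor.
Variables (X : ringed_space) (M N : premod X).
Implicit Types U V W : opens X.

Definition ptens_sec U : lmodType (rs_sec U) := tensor (pm_sec M U) (pm_sec N U).

Definition res_seq U V (h : osub V U) (s : seq (pm_sec M U * pm_sec N U)) :=
  [seq (pm_res h mn.1, pm_res h mn.2) | mn <- s].

Lemma res_seq_eq U V (h : osub V U) s t :
  tensor_eq s t -> tensor_eq (res_seq h s) (res_seq h t).
Proof.
elim=> {s t} /=.
- by move=> s; exact: tensor_refl.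
- by move=> s t _; exact: tensor_sym.
- by move=> s t r _ st _; exact: tensor_trans.
- by move=> s s' t t' _ ss' _ tt'; rewrite /res_seq !map_cat; exact: tensor_cat.
- by move=> s t; rewrite /res_seq !map_cat; exact: tensor_catC.
- by move=> n; rewrite raddf0; exact: tensor_0.
- by move=> m m' n; rewrite raddfD; exact: tensor_Dl.
- by move=> m n n'; rewrite raddfD; exact: tensor_Dr.
- by move=> b m n; rewrite !pm_resZ; exact: tensor_Z.
Qed.

Definition ptens_res U V (h : osub V U) (z : ptens_sec U) : ptens_sec V :=
  tens (res_seq h (qrepr z)).

Lemma ptens_resE U V (h : osub V U) s : ptens_res h (tens s) = tens (res_seq h s).
Proof.
by apply: tens_eq; apply: res_seq_eq; exact: (qrepr_rel (tensor_equiv _ _)).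
Qed.

Lemma ptens_resD U V (h : osub V U) : {morph ptens_res h : z w / z + w}.
Proof.
elim/tensW=> s; elim/tensW=> t.
by rewrite tensD !ptens_resE tensD /res_seq map_cat.
Qed.

Lemma ptens_resZ U V (h : osub V U) a z :
  ptens_res h (a *: z) = rs_res h a *: ptens_res h z.
Proof.
elim/tensW: z => s.
rewrite tensZ !ptens_resE tensZ; congr tens.
by rewrite /res_seq /scale_seq -!map_comp; apply: eq_map => mn /=; rewrite pm_resZ.
Qed.

Lemma ptens_res_zmod U V (h : osub V U) : zmod_morphism (ptens_res h).
Proof.
move=> z w; rewrite ptens_resD -!scaleN1r ptens_resZ.
by rewrite rmorphN rmorph1.
Qed.

HB.instance Definition _ U V (h : osub V U) :=
  GRing.isZmodMorphism.Build _ _ (ptens_res h) (ptens_res_zmod h).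

Lemma ptens_res_id U (h : osub U U) z : ptens_res h z = z.
Proof.
elim/tensW: z => s; rewrite ptens_resE; congr tens.
by elim: s => [|[m n] s IHs] //=; rewrite !pm_res_id IHs.
Qed.

Lemma ptens_res_comp U V W (h : osub V U) (k : osub W V) (l : osub W U) z :
  ptens_res k (ptens_res h z) = ptens_res l z.
Proof.
elim/tensW: z => s; rewrite !ptens_resE; congr tens.
by elim: s => [|[m n] s IHs] //=; rewrite !(pm_res_comp h k l) IHs.
Qed.

Definition presheaf_tensor : premod X :=
  @Premod X ptens_sec (fun U V h => ptens_res h)
    ptens_res_id ptens_res_comp ptens_resZ.

End PresheafTensor.

Definition sheaf_tensor (X : ringed_space) (M N : smod X) : smod X :=
  sheafify (presheaf_tensor M N).

Definition structure_mod (X : ringed_space) : smod X :=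
  @Smod X (@Premod X (fun U => (rs_sec U)^o) (fun U V h => @rs_res X U V h)
    (@rs_res_id X) (@rs_res_comp X) (fun U V h => rmorphM (rs_res h)))
    (@rs_sheaf X).

Fixpoint tensor_power (X : ringed_space) (L : smod X) (n : nat) : smod X :=
  if n is n'.+1 then sheaf_tensor (tensor_power L n') L else structure_mod X.

Definition invertible (X : ringed_space) (L : smod X) : Prop :=
  forall x : X, exists U : opens X, U x /\
  exists e : forall V : opens X, osub V U -> {linear (rs_sec V)^o -> pm_sec L V},
    (forall V (VU : osub V U), bijective (e V VU)) /\
    (forall V W (VU : osub V U) (WU : osub W U) (h : osub W V) (s : rs_sec V),
       pm_res h (e V VU s) = e W WU (rs_res h s)).

(* [pchar R] is only available for nonzero rings. *)
Definition ring_char (R : comPzRingType) (p : nat) : Prop :=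
  prime p /\ p%:R = 0 :> R.

Definition has_char (X : ringed_space) (p : nat) : Prop :=
  forall U : opens X, ring_char (rs_sec U) p.

Section FrobeniusModule.
Variables (R : comPzRingType) (p : nat) (Rp : ring_char R p).

Lemma char_exprD (a b : R) : (a + b) ^+ p = a ^+ p + b ^+ p.
Proof.
case: Rp => p_pr p0; have defp := prednK (prime_gt0 p_pr).
rewrite exprDn big_ord_recr subnn -defp big_ord_recl /= defp.
rewrite subn0 mulr1 mul1r bin0 binn big1 ?addr0 // => i _.
have /dvdnP[k ->] : (p %| 'C(p, bump 0 i))%N.
  by apply: prime_dvd_bin => //=; rewrite /bump /= add1n -{2}defp ltnS (valP i).
by rewrite -mulr_natl natrM p0 mulr0 mul0r.
Qed.

(* The ring R as an R-module through its Frobenius endomorphism. *)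
Definition frob_mod (_ : ring_char R p) : Type := R.
HB.instance Definition _ := GRing.Zmodule.on (frob_mod Rp).

Definition frob_scale (a : R) (s : frob_mod Rp) : frob_mod Rp :=
  a ^+ p * (s : R).

Lemma frob_scaleA a b s : frob_scale a (frob_scale b s) = frob_scale (a * b) s.
Proof. by rewrite /frob_scale mulrA exprMn. Qed.
Lemma frob_scale1 : left_id 1 frob_scale.
Proof. by move=> s; rewrite /frob_scale expr1n mul1r. Qed.
Lemma frob_scaleDr : right_distributive frob_scale +%R.
Proof. by move=> a s t; exact: mulrDr. Qed.
Lemma frob_scaleDl s : {morph frob_scale^~ s : a b / a + b}.
Proof. by move=> a b; rewrite /frob_scale char_exprD; exact: mulrDl. Qed.

HB.instance Definition _ := GRing.Zmodule_isLmodule.Build R (frob_mod Rp)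
  frob_scaleA frob_scale1 frob_scaleDr frob_scaleDl.

Definition frob (s : R^o) : frob_mod Rp := (s : R) ^+ p.

Lemma frob_linear : linear frob.
Proof.
by move=> a s t; rewrite /frob char_exprD; congr (_ + _); exact: exprMn.
Qed.

HB.instance Definition _ := GRing.isLinear.Build R R^o (frob_mod Rp) *:%R frob frob_linear.

End FrobeniusModule.

Section FrobeniusPushforward.
Variables (X : ringed_space) (p : nat) (Xp : has_char X p).

Lemma frob_resZ (U V : opens X) (h : osub V U) (a : rs_sec U) (s : frob_mod (Xp U)) :
  rs_res h (a *: s) = rs_res h a *: (rs_res h s : frob_mod (Xp V)).
Proof.
rewrite [a *: s]/(_ * _) rmorphM; congr (_ * _).
exact: rmorphXn.
Qed.

(* F_* O_X for the Frobenius map F of X, the identity on the space. *)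
Definition frob_pushforward : smod X :=
  @Smod X (@Premod X (fun U => frob_mod (Xp U)) (fun U V h => @rs_res X U V h)
    (@rs_res_id X) (@rs_res_comp X) frob_resZ)
    (@rs_sheaf X).

Lemma frobenius_res (U V : opens X) (h : osub V U) (s : rs_sec U) :
  rs_res h (frob (Xp U) s) = frob (Xp V) (rs_res h s).
Proof. exact: rmorphXn. Qed.

Definition frobenius : mhom (structure_mod X) frob_pushforward :=
  @Mhom X (structure_mod X) frob_pushforward (fun U => frob (Xp U)) frobenius_res.

Definition frobenius_split : Prop :=
  exists phi : mhom frob_pushforward (structure_mod X),
    forall U (s : rs_sec U), phi U (frobenius U s) = s.

End FrobeniusPushforward.

Section Cohomology.
Variable X : topologicalType.
Implicit Types F G H I : sheaf X.

Definition monomorphism F G (f : ab_hom F G) : Prop :=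
  forall U (s t : F U), f U s = f U t -> s = t.

(* The kernel of g is the image of f, i.e. consists of the sections which are
   locally in the range of f. *)
Definition exact_at F G H (f : ab_hom F G) (g : ab_hom G H) : Prop :=
  forall U (t : G U), g U t = 0 <->
    forall x, U x -> exists (V : opens X) (h : osub V U),
      V x /\ exists s : F V, f V s = ps_res h t.

Definition injective_sheaf I : Prop :=
  forall F G (i : ab_hom F G) (f : ab_hom F I), monomorphism i ->
    exists g : ab_hom G I, forall U s, g U (i U s) = f U s.

Record injective_resolution F := InjectiveResolution {
  ir_sheaf : nat -> sheaf X;
  ir_injective : forall n, injective_sheaf (ir_sheaf n);
  ir_aug : ab_hom F (ir_sheaf 0);
  ir_d : forall n, ab_hom (ir_sheaf n) (ir_sheaf n.+1);
  ir_mono : monomorphism ir_aug;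
  ir_exact0 : exact_at ir_aug (ir_d 0);
  ir_exactS : forall n, exact_at (ir_d n) (ir_d n.+1) }.

Definition cocycle F (R : injective_resolution F) n
    (s : ir_sheaf R n (opensT X)) : Prop :=
  ir_d R n (opensT X) s = 0.

Definition coboundary F (R : injective_resolution F) n :
    ir_sheaf R n (opensT X) -> Prop :=
  if n is n'.+1 then fun s => exists t, ir_d R n' (opensT X) t = s
  else fun s => s = 0.

(* H^i(X, F) = 0. The cohomology groups of the complex of global sections do
   not depend, up to isomorphism, on the injective resolution of F, and vanish
   in negative degrees. *)
Definition cohomology_vanishes (i : int) F : Prop :=
  match i with
  | Posz n => exists R : injective_resolution F,
      forall s : ir_sheaf R n (opensT X), cocycle s -> coboundary s
  | Negz _ => True
  end.

End Cohomology.

(* Main.v *)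
(* Let q = p^n. The map s |-> s^q from L to L^q is additive, because it is
   a g |-> a^q g^q in terms of a local generator g and the characteristic is p.
   If psi : O -> O is the n-th iterate of the Frobenius splitting, then
   psi (a^q b) = a psi b, so the local formulas a g^q |-> psi a g do not depend on
   g and glue to an additive map L^q -> L that is a left inverse of s |-> s^q.
   Thus the abelian sheaf L is a direct summand of L^q, and its cohomology is a
   direct summand of that of L^q, which vanishes for n large. Transporting the
   vanishing requires an injective resolution of L: every sheaf embeds in a
   product of sheaves of functions with values in powers of Q/Z. *)

Require Import Defs.
From HB Require Import structures.
From mathcomp Require Import all_boot all_order all_algebra ring_quotient.
From mathcomp Require Import all_classical topology.

Set Implicit Arguments.
Unset Strict Implicit.
Unset Printing Implicit Defensive.

Import GRing.Theory Num.Theory.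
Local Open Scope classical_set_scope.
Local Open Scope ring_scope.

(** * Divisible groups *)

Definition additive_of (G H : zmodType) (f : G -> H) (fB : zmod_morphism f) :
    {additive G -> H} :=
  HB.pack_for {additive G -> H} f (GRing.isZmodMorphism.Build G H f fB).

Section DivisibleGroups.

(** Divisibility makes D an injective abelian group; torsion lets characters take a nonzero value at
    a prescribed element. The shifts [n.+1] and [n.+2] exclude the factor 0 and the factors 0 and 1,
    respectively. *)
Record divisible_cogenerator (D : zmodType) : Prop := DivisibleCogenerator {
  divisible : forall (n : nat) (d : D), exists q, q *+ n.+1 = d;
  torsion : forall n : nat, exists2 t : D, t != 0 & t *+ n.+2 = 0 }.

Record subgroup (G : zmodType) (K : set G) : Prop := Subgroup {
  subgroup0 : K 0;
  subgroupB : forall x y, K x -> K y -> K (x - y) }.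
Arguments subgroupB {G K} _ [x y].

Lemma subgroupN (G : zmodType) (K : set G) x : subgroup K -> K x -> K (- x).
Proof. by move=> [K0 KB] Kx; rewrite -sub0r; exact: KB. Qed.

Lemma subgroupD (G : zmodType) (K : set G) x y :
  subgroup K -> K x -> K y -> K (x + y).
Proof.
by move=> sK Kx Ky; rewrite -(opprK y); apply: (subgroupB sK Kx (subgroupN sK Ky)).
Qed.

Lemma subgroupMz (G : zmodType) (K : set G) x (n : int) :
  subgroup K -> K x -> K (x *~ n).
Proof.
move=> sK Kx; have Kn m : K (x *+ m).
  elim: m => [|m IHm]; first by rewrite mulr0n; exact: subgroup0 sK.
  by rewrite mulrS; exact: subgroupD.
by case: n => m; [exact: Kn|rewrite NegzE mulrNz; exact: subgroupN (Kn _)].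
Qed.

Variables (H D : zmodType) (DD : divisible_cogenerator D).
Implicit Types S : set (H * D).

(* The graph of a homomorphism to D from a subgroup of H. *)
Definition hom_graph S : Prop := subgroup S /\ forall d, S (0, d) -> d = 0.

Definition graph_adjoin S b q : set (H * D) :=
  [set z | exists2 w, S w & exists n : int, z = w + (b *~ n, q *~ n)].

Lemma graph_adjoin_subgroup S b q : subgroup S -> subgroup (graph_adjoin S b q).
Proof.
move=> sS; split=> [|_ _ [w Sw [n ->]] [w' Sw' [n' ->]]].
  by exists 0; [exact: subgroup0 sS|exists 0; rewrite !mulr0z addr0].
exists (w - w'); first exact: (subgroupB sS Sw Sw').
exists (n - n'); rewrite !mulrzBr opprD addrACA; congr (_ + _).
Qed.

(** The second hypothesis makes the value q at b compatible with the values that S already assigns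
    to multiples of b. *)
Lemma graph_adjoin_hom_graph S b q : hom_graph S ->
  (forall n d, S (b *~ n, d) -> d = q *~ n) -> hom_graph (graph_adjoin S b q).
Proof.
move=> [sS fS] Sq; split; first exact: graph_adjoin_subgroup.
move=> d [[h e] Swd [n []]] /esym/eqP; rewrite addr_eq0 => /eqP hE ->.
have /Sq <- : S (b *~ n, - e).
  have <- : (- h, - e) = (b *~ n, - e) by rewrite hE opprK.
  exact: (subgroupN sS Swd).
by rewrite subrr.
Qed.

(* Asking for [q != 0] lets the same extension step also separate b from the
   domain of S. *)
Lemma hom_graph_extend1 S b : hom_graph S -> (forall d, ~ S (b, d)) ->
  exists2 q, q != 0 & hom_graph (graph_adjoin S b q).
Proof.
move=> hS nb; have [sS fS] := hS.
pose P n := `[< exists d, S (b *+ n.+1, d) >].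
(* If no positive multiple of b is in the domain of S, every q is compatible with S, so any nonzero
   element of D serves. *)
have [[n Pn]|nP] := pselect (exists n, P n); last first.
  have [q q0 _] := torsion DD 0; exists q => //.
  apply: graph_adjoin_hom_graph => // -[[|n]|n] d.
  - by rewrite !mulr0z => /fS.
  - by move=> Sd; exfalso; apply: nP; exists n; apply/asboolP; exists d.
  - rewrite NegzE mulrNz => /(subgroupN sS) Sd; exfalso; apply: nP; exists n.
    apply/asboolP; exists (- d).
    by have <- : (- - (b *~ n.+1), - d) = (b *+ n.+1, - d) by rewrite opprK.
(* The least positive multiple of b in the domain is [b *+ m.+1], with value c. The case [m = 0] is
   excluded because b is not in the domain. *)
have [{n Pn}m /asboolP[c Sc] mmin] := ex_minnP (ex_intro (fun n => is_true (P n)) n Pn).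
case: m => [|m] in Sc mmin; first by case: (nb c).
(* The order of b modulo the domain is now [m.+2]. Any q with [q *+ m.+2 = c] is compatible with S:
   dividing n by [m.+2] leaves a remainder r with [b *~ r] in the domain, and minimality forces r =
   0. *)
suff [q q0 qc] : exists2 q : D, q != 0 & q *+ m.+2 = c.
  exists q => //; apply: graph_adjoin_hom_graph => // n d Sd.
  have m0 : (m.+2 : int) != 0 by [].
  have := divz_eq n m.+2%:Z; have := modz_ge0 n m0.
  have := ltz_pmod n (isT : 0 < m.+2%:Z).
  set k := divz _ _; case: (modz _ _) => // r rm _ nE.
  have : S (b *~ r, d - c *~ k).
    have := subgroupB sS Sd (subgroupMz k sS Sc).
    suff -> : (b *~ n, d) - (b *+ m.+2, c) *~ k = (b *~ r, d - c *~ k) by [].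
    have mz (x : H) (y : D) j : (x, y) *~ j = (x *~ j, y *~ j).
      have mn i : (x, y) *+ i = (x *+ i, y *+ i).
        by elim: i => // i IHi; rewrite !mulrS IHi.
      by case: j => i; rewrite ?NegzE ?mulrNz; [exact: mn|rewrite -pmulrn mn].
    rewrite mz; congr (_, _); rewrite nE mulrzDr pmulrn -mulrzA mulrC.
    by rewrite addrC addKr.
  case: r rm nE => [|r] rm nE.
    rewrite mulr0z => /fS /eqP; rewrite subr_eq0 => /eqP ->.
    by rewrite nE addr0 -qc pmulrn -mulrzA mulrC.
  move=> Sr; have /mmin : P r by apply/asboolP; exists (d - c *~ k).
  by move: rm; rewrite ltz_nat ltnS ltnNge => /negP.
(* If the q given by divisibility is 0, then c = 0 and a nonzero element killed by [m.+2] replaces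
   it. *)
have [q qc] := divisible DD m.+1 c.
have [q0|] := eqVneq q 0; last by exists q.
have [t t0 tm] := torsion DD m; exists t => //.
by rewrite tm -qc q0 mul0rn.
Qed.

(** This is the injectivity of D. Zorn's lemma gives a maximal graph containing S; its domain is all
    of H, since otherwise [hom_graph_extend1] would enlarge it. *)
Lemma hom_graph_total S : hom_graph S ->
  exists chi : {additive H -> D}, forall h d, S (h, d) -> chi h = d.
Proof.
move=> hS; pose P A := hom_graph (S `|` A).
(* Zorn_bigcup also considers the empty chain, whose union is not a graph;
   hence the union with S in P. *)
have [F FP Ftot|A [PA Amax]] := @Zorn_bigcup _ P.
  (* Since F is a chain, two elements of the union lie in a single graph, from which the union
     inherits closure under subtraction and single-valuedness. *)
  have common z w : (S `|` \bigcup_(X in F) X) z -> (S `|` \bigcup_(X in F) X) w ->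
      exists B, [/\ hom_graph B, B `<=` S `|` \bigcup_(X in F) X, B z & B w].
    have sub X : F X -> S `|` X `<=` S `|` \bigcup_(X in F) X.
      by move=> FX; apply: setUS; exact: bigcup_sup.
    move=> [Sz|[X FX Xz]] [Sw|[Y FY Yw]].
    - by exists S; split=> //; exact: subsetUl.
    - by exists (S `|` Y); split; [exact: FP|exact: sub|left|right].
    - by exists (S `|` X); split; [exact: FP|exact: sub|right|left].
    - have [XY|YX] := Ftot _ _ FX FY.
        by exists (S `|` Y); split; [exact: FP|exact: sub|right; exact: XY|right].
      by exists (S `|` X); split; [exact: FP|exact: sub|right|right; exact: YX].
  split=> [|d Sd]; last by have [B [[_ fB] _ /fB]] := common _ _ Sd Sd.
  split=> [|z w Sz Sw]; first by left; exact: subgroup0 hS.1.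
  have [B [[sB _] BS Bz Bw]] := common _ _ Sz Sw; exact/BS/(subgroupB sB).
set B := S `|` A in PA; have [sB fB] := PA.
have tot h : exists d, B (h, d).
  apply: contrapT => nh.
  have [|q _ gB] := hom_graph_extend1 (b := h) PA.
    by move=> d Bd; apply: nh; exists d.
  have BB : B `<=` graph_adjoin B h q.
    by move=> z Bz; exists z => //; exists 0; rewrite !mulr0z addr0.
  apply: (Amax (graph_adjoin B h q)); last first.
    rewrite /P; suff -> : S `|` graph_adjoin B h q = graph_adjoin B h q by [].
    by apply/classical_sets.setUidPr; move=> z Sz; apply: BB; left.
  split; first by move=> z Az; apply: BB; right.
  move=> /(_ (h, q)) hq; apply: nh; exists q; right; apply: hq.
  exists 0; first exact: subgroup0 sB.
  by exists 1; rewrite add0r !mulr1z.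
pose chi h := projT1 (cid (tot h)).
have chiP h d : B (h, d) -> chi h = d.
  move=> Bd; apply/eqP; rewrite -subr_eq0; apply/eqP/fB.
  by rewrite -(subrr h); exact: (subgroupB sB (projT2 (cid (tot h))) Bd).
have chiB : zmod_morphism chi.
  move=> h k; apply: chiP.
  exact: (subgroupB sB (projT2 (cid (tot h))) (projT2 (cid (tot k)))).
exists (additive_of chiB) => h d Sd /=; apply: chiP; by left.
Qed.

(** The zero homomorphism on K extends to b with a nonzero value, and from there to H. *)
Lemma separate_subgroup (K : set H) b : subgroup K -> ~ K b ->
  exists chi : {additive H -> D}, (forall h, K h -> chi h = 0) /\ chi b != 0.
Proof.
move=> sK nKb; pose S : set (H * D) := [set z | K z.1 /\ z.2 = 0].
have hS : hom_graph S.
  split; last by move=> d [].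
  split=> [|z w [Kz z0] [Kw w0]]; first by split=> //; exact: subgroup0 sK.
  by split; [exact: (subgroupB sK Kz Kw)|rewrite /= z0 w0 subrr].
have [|q q0 /hom_graph_total [chi chiP]] := hom_graph_extend1 (b := b) hS.
  by move=> d [].
exists chi; split=> [h Kh|].
  by apply: chiP; exists (h, 0) => //; exists 0; rewrite !mulr0z addr0.
suff -> : chi b = q by [].
apply: chiP; exists 0; first by split=> //; exact: subgroup0 sK.
by exists 1; rewrite add0r !mulr1z.
Qed.

(* The coordinate of chi at b is a character killing K, and not b unless b is
   in K. *)
Lemma subgroup_kernel (K : set H) : subgroup K ->
  exists chi : {additive H -> (H -> D)}, forall h, chi h = 0 <-> K h.
Proof.
move=> sK.
have sep b : exists chi : {additive H -> D},
    (forall h, K h -> chi h = 0) /\ (~ K b -> chi b != 0).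
  have [Kb|nKb] := pselect (K b).
    have hS : hom_graph [set z | z.2 = 0].
      split=> [|d //]; split=> //= z w -> ->; exact: subrr.
    have [chi chiP] := hom_graph_total hS.
    by exists chi; split=> // h _; exact: chiP.
  have [chi [chiK chib]] := separate_subgroup sK nKb.
  by exists chi.
pose chi h := fun b => projT1 (cid (sep b)) h.
have chiB : zmod_morphism chi.
  by move=> h k; apply/funext => b; exact: raddfB.
exists (additive_of chiB) => h /=; split=> [chi0|Kh]; last first.
  by apply/funext => b; have [+ _] := projT2 (cid (sep b)); exact.
apply: contrapT => nKh; have [_ /(_ nKh)] := projT2 (cid (sep h)).
by rewrite -/(chi h h) chi0 eqxx.
Qed.

End DivisibleGroups.

(** The group Q/Z. The construction [ideal_quot] accepts an additive subgroup, so it applies to Z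
    although Z is not an ideal of Q. *)
Notation QmodZ :=
  {ideal_quot GRing.ZmodClosed.clone rat (@Num.int_num_subdef rat) _}.

Lemma QmodZ_eq0 (x : rat) : \pi_(QmodZ)%qT x = 0 <-> x \is a Num.int.
Proof.
have <- : \pi_(QmodZ)%qT 0 = 0 by exact: raddf0.
have e : (x - 0 \is a Num.int) = (x == 0 %[mod QmodZ])%qT.
  exact: Quotient.idealrBE.
by rewrite -{2}(subr0 x) e; split=> [->|/eqP].
Qed.

Lemma QmodZ_divisible_cogenerator : divisible_cogenerator QmodZ.
Proof.
have n0 n : (n.+1%:R : rat) != 0 by rewrite pnatr_eq0.
split=> n.
  elim/quotW=> x; exists (\pi_(QmodZ)%qT (x / n.+1%:R)).
  by rewrite -raddfMn -[_ *+ _]mulr_natr divfK.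
exists (\pi_(QmodZ)%qT (n.+2%:R^-1)); last first.
  by rewrite -raddfMn -[_ *+ _]mulr_natr mulVf //; apply/QmodZ_eq0.
(* The class of 1/(n + 2) is nonzero because a nonzero integer has absolute value at least 1. *)
apply/eqP => /QmodZ_eq0 /norm_intr_ge1; rewrite invr_eq0 n0 => /(_ isT).
by rewrite normfV normr_nat invf_ge1 ?ltr0n // lern1.
Qed.

(** * Enough injective sheaves *)

Lemma germB (X : topologicalType) (F : presheaf X) (x : X) (U : opens X)
  (Ux : U x) (s t : F U) : germ Ux (s - t) = germ Ux s - germ Ux t.
Proof.
rewrite [RHS]/(stalkD (germ Ux s) (stalkN (germ Ux t))).
by rewrite stalkNE; exact/esym/stalkDE.
Qed.

Lemma germ0 (X : topologicalType) (F : presheaf X) (x : X) (U : opens X)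
  (Ux : U x) : germ Ux (0 : F U) = 0.
Proof. by rewrite -(stalk0E F Ux). Qed.

(** Both s and t glue the restrictions of s to neighbourhoods on which they agree. The bare
    [sheaf_axiom] form also covers the structure sheaf. *)
Lemma sheaf_axiom_ext (X : topologicalType) (F : opens X -> Type)
    (res : forall U V, osub V U -> F U -> F V) :
  (forall U V W (h : osub V U) (k : osub W V) (l : osub W U) s,
     res _ _ k (res _ _ h s) = res _ _ l s) ->
  sheaf_axiom res -> forall (U : opens X) (s t : F U),
  (forall x, U x -> exists (V : opens X) (h : osub V U),
     V x /\ res _ _ h s = res _ _ h t) -> s = t.
Proof.
move=> res_comp Fsh U s t st.
pose V (i : {x | U x}) := projT1 (cid (st _ (projT2 i))).
pose h (i : {x | U x}) := projT1 (cid (projT2 (cid (st _ (projT2 i))))) : osub (V i) U.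
have hP i : V i (projT1 i) /\ res _ _ (h i) s = res _ _ (h i) t.
  exact: (projT2 (cid (projT2 (cid (st _ (projT2 i)))))).
have [|i j W hi hj|r [_ rE]] := Fsh U _ V h _ (fun i => res _ _ (h i) s).
- by move=> x Ux; exists (exist _ x Ux); exact: (hP (exist _ x Ux)).1.
- by rewrite !(res_comp _ _ _ _ _ (osub_trans (h i) hi)).
by rewrite -(rE s) // -(rE t) // => i; case: (hP i).
Qed.

Lemma sheaf_ext (X : topologicalType) (F : sheaf X) (U : opens X) (s t : F U) :
  (forall x, U x -> exists (V : opens X) (h : osub V U),
     V x /\ ps_res h s = ps_res h t) -> s = t.
Proof. exact: (sheaf_axiom_ext (@ps_res_comp X F) (@sheafP X F)). Qed.

Section ProductSheaf.
Variables (X : topologicalType) (G : X -> zmodType).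

(** Without a local condition, the sections over U form the product of the groups G x for x in U:
    the sheaf is a product of skyscrapers. *)
Definition all_functions : local_class G :=
  @LocalClass X G (fun _ _ => True) (fun _ _ _ _ _ => I) (fun _ => I)
    (fun _ _ _ => I) (fun _ _ _ _ _ => I).

Lemma locfun_res_zmod (U V : opens X) (h : osub V U) :
  zmod_morphism (@locfun_res X G all_functions U V h).
Proof. by move=> f g; apply: locfun_ext. Qed.

Lemma locfun_res_id (U : opens X) (h : osub U U) (f : locfun all_functions U) :
  locfun_res h f = f.
Proof. by apply: locfun_ext => x Ux /=; exact: locfun_irr. Qed.

Lemma locfun_res_comp (U V W : opens X) (h : osub V U) (k : osub W V)
  (l : osub W U) (f : locfun all_functions U) :
  locfun_res k (locfun_res h f) = locfun_res l f.
Proof. by apply: locfun_ext => x Ux /=; exact: locfun_irr. Qed.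

Definition product_presheaf : presheaf X :=
  @Presheaf X (fun U => locfun all_functions U)
    (fun U V h => additive_of (locfun_res_zmod h)) locfun_res_id locfun_res_comp.

Definition product_sheaf : sheaf X :=
  @Sheaf X product_presheaf (@locfun_sheaf X G all_functions).

Lemma product_section_subproof (U : opens X) (f : forall x, U x -> G x) x :
  U x -> exists (V : opens X) (h : osub V U),
    V x /\ all_functions V (fun y Vy => f y (h y Vy)).
Proof. by move=> Ux; exists U, (@osub_refl _ U). Qed.

Definition product_section (U : opens X) (f : forall x, U x -> G x) :
  product_sheaf U := LocFun f (product_section_subproof f).

Variables (F : presheaf X) (c : forall x, {additive stalk F x -> G x}).

(** A map into a product of skyscrapers amounts to a family of maps out of the stalks. *)
Definition stalkwise_fun (U : opens X) (s : F U) : product_sheaf U :=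
  product_section (fun x Ux => c x (germ Ux s)).

Lemma stalkwise_zmod (U : opens X) : zmod_morphism (@stalkwise_fun U).
Proof.
move=> s t; apply: locfun_ext => x Ux /=; rewrite -raddfB; congr (c x _).
exact: germB.
Qed.

Lemma stalkwise_res (U V : opens X) (h : osub V U) (s : F U) :
  ps_res h (stalkwise_fun s) = stalkwise_fun (ps_res h s).
Proof. by apply: locfun_ext => x Vx /=; congr (c x _); exact/esym/germ_res. Qed.

Definition stalkwise : ab_hom F product_sheaf :=
  @AbHom X F product_sheaf (fun U => additive_of (@stalkwise_zmod U)) stalkwise_res.

End ProductSheaf.

Section EnoughInjectives.
Variables (X : topologicalType).
Implicit Types F G : sheaf X.

(** The map f amounts to a Q/Z-valued character of the stalk of F at x for each x and each y in T x.
    As i is injective on stalks, each character extends to the stalk of G. *)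
Lemma product_sheaf_injective (T : X -> Type) :
  injective_sheaf (product_sheaf (fun x => T x -> QmodZ)).
Proof.
move=> F G i f imono.
have ext x (y : T x) : exists c : {additive stalk G x -> QmodZ},
    forall (V : opens X) (Vx : V x) (s : F V), c (germ Vx (i V s)) = f V s x Vx y.
  pose S : set (stalk G x * QmodZ) := [set z |
    exists (V : opens X) (Vx : V x) (s : F V), z = (germ Vx (i V s), f V s x Vx y)].
  have hS : hom_graph S.
    split; first split.
    - exists (opensT X), I, 0; by rewrite !raddf0 germ0.
    - move=> _ _ [V [Vx [s ->]]] [W [Wx [t ->]]].
      have hx : opensI V W x by split.
      exists (opensI V W), hx, (ps_res (@osubIl _ V W) s - ps_res (@osubIr _ V W) t).
      rewrite !raddfB /= -!ab_hom_res germB !germ_res.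
      congr (_, _).
      rewrite (locfun_irr (f V s) Vx (osubIl hx)).
      by rewrite (locfun_irr (f W t) Wx (osubIr hx)).
    (* If the germ of [i V s] is zero, then i kills s near x; so s is zero near x, and so is f s. *)
    move=> d [V [Vx [s sE]]]; rewrite (congr1 snd sE : d = _).
    have /germ_eqP[W [h [k [Wx e]]]] := etrans (germ0 G Vx) (congr1 fst sE).
    suff e0 : ps_res k s = 0.
      have := ab_hom_res f k s; rewrite e0 raddf0.
      move/(congr1 (fun g : product_sheaf (fun x => T x -> QmodZ) W =>
        locfun_fun g x Wx y)) => E.
      by rewrite (locfun_irr _ Vx (k x Wx)); exact: E.
    by apply: (imono W); rewrite -ab_hom_res -e !raddf0.
  have [c cP] := hom_graph_total QmodZ_divisible_cogenerator hS.
  by exists c => V Vx s; apply: cP; exists V, Vx, s.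
pose c x z y := projT1 (cid (ext x y)) z.
have cB x : zmod_morphism (c x).
  by move=> z w; apply/funext => y; exact: raddfB.
exists (stalkwise (fun x => additive_of (cB x))) => U s.
apply: locfun_ext => x Ux; apply/funext => y /=.
exact: (projT2 (cid (ext x y)) U Ux s).
Qed.

(** Being locally in the range of u is a condition on germs, and at each x some map to a power of
    Q/Z has the germs coming from u as its kernel. This embeds the cokernel in an injective sheaf
    without constructing the cokernel. *)
Lemma cokernel_embedding F G (u : ab_hom F G) :
  exists (I : sheaf X) (v : ab_hom G I), injective_sheaf I /\ exact_at u v.
Proof.
pose K x : set (stalk G x) := [set z |
  exists (V : opens X) (Vx : V x) (s : F V), z = germ Vx (u V s)].
have sK x : subgroup (K x).
  split=> [|_ _ [V [Vx [s ->]]] [W [Wx [t ->]]]].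
    by exists (opensT X), Logic.I, 0; rewrite raddf0 germ0.
  have hx : opensI V W x by split.
  exists (opensI V W), hx, (ps_res (@osubIl _ V W) s - ps_res (@osubIr _ V W) t).
  by rewrite !raddfB /= -!ab_hom_res germB !germ_res.
pose c x := projT1 (cid (subgroup_kernel QmodZ_divisible_cogenerator (sK x))).
have cP x z : c x z = 0 <-> K x z.
  exact: (projT2 (cid (subgroup_kernel QmodZ_divisible_cogenerator (sK x))) z).
exists (product_sheaf (fun x => stalk G x -> QmodZ)), (stalkwise c).
split=> [|U t]; first exact: product_sheaf_injective.
split=> [t0 x Ux|tP].
  have /cP[V [Vx [s]]] : c x (germ Ux t) = 0.
    exact: (congr1 (fun g : product_sheaf _ U => locfun_fun g x Ux) t0).
  move=> /germ_eqP [W [h [k [Wx e]]]]; exists W, h; split=> //.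
  by exists (ps_res k s); rewrite e ab_hom_res.
apply: locfun_ext => x Ux /=; apply/cP.
have [V [h [Vx [s e]]]] := tP x Ux; exists V, Vx, s.
by rewrite e germ_res.
Qed.

(** The source and target are bundled because they change at each stage of the recursive
    construction of a resolution. *)
Record arrow := Arrow {
  arrow_dom : sheaf X;
  arrow_cod : sheaf X;
  arrow_hom :> ab_hom arrow_dom arrow_cod }.

Definition cokernel_arrow (u : arrow) : arrow :=
  Arrow (projT1 (cid (projT2 (cid (cokernel_embedding u))))).

Lemma cokernel_arrow_injective u : injective_sheaf (arrow_cod (cokernel_arrow u)).
Proof. exact: (projT2 (cid (projT2 (cid (cokernel_embedding u))))).1. Qed.

Lemma cokernel_arrow_exact u :
  @exact_at X (arrow_dom u) (arrow_cod u) (arrow_cod (cokernel_arrow u))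
    u (cokernel_arrow u).
Proof. exact: (projT2 (cid (projT2 (cid (cokernel_embedding u))))).2. Qed.

Lemma zero_zmod F G U : zmod_morphism (fun _ : F U => 0 : G U).
Proof. by move=> s t; rewrite subr0. Qed.

Lemma zero_hom_res F G (U V : opens X) (h : osub V U) (s : F U) :
  ps_res h (additive_of (@zero_zmod F G U) s) =
  additive_of (@zero_zmod F G V) (ps_res h s).
Proof. exact: raddf0. Qed.

Definition zero_hom F G : ab_hom F G := AbHom (@zero_hom_res F G).

(* The cokernel of the zero map F -> F is F, so the resolution starts with an
   embedding of F. *)
Fixpoint resolution_arrow F n : arrow :=
  cokernel_arrow (if n is n'.+1 then resolution_arrow F n' else Arrow (zero_hom F F)).

Lemma injective_resolution_exists F : inhabited (injective_resolution F).
Proof.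
pose J n := arrow_cod (resolution_arrow F n).
pose d n : ab_hom (J n) (J n.+1) := resolution_arrow F n.+1.
pose a : ab_hom F (J 0) := resolution_arrow F 0.
have a0 := @cokernel_arrow_exact (Arrow (zero_hom F F)) : exact_at (zero_hom F F) a.
constructor; apply: (@InjectiveResolution X F J _ a d).
- by case=> [|n]; exact: cokernel_arrow_injective.
- move=> U s t e; apply/eqP; rewrite -subr_eq0; apply/eqP.
  have {e} /a0 st0 : a U (s - t) = 0 by rewrite raddfB e subrr.
  apply: (sheaf_ext (F := F)) => x /st0 [V [h [Vx [r rE]]]].
  by exists V, h; split=> //; rewrite -rE raddf0.
- exact: @cokernel_arrow_exact (resolution_arrow F 0).
- by move=> n; exact: @cokernel_arrow_exact (resolution_arrow F n.+1).
Qed.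

End EnoughInjectives.

(** * Homomorphisms defined locally *)

Section GlueHomomorphism.
Variables (X : topologicalType) (F : presheaf X) (G : sheaf X).
(** P s r declares r to be the value at s. Values need to exist only locally, and [P_sub] with [P_0]
    makes them unique. *)
Variable P : forall U : opens X, F U -> G U -> Prop.
Hypothesis P_res : forall (U V : opens X) (h : osub V U) s r,
  P s r -> P (ps_res h s) (ps_res h r).
Hypothesis P_sub : forall U s r s' r', @P U s r -> P s' r' -> P (s - s') (r - r').
Hypothesis P_0 : forall U r, @P U 0 r -> r = 0.
Hypothesis P_local : forall (U : opens X) (s : F U) x, U x ->
  exists (V : opens X) (h : osub V U), V x /\ exists r, P (ps_res h s) r.

(** The local closure of P. Unlike P it is total, since local values agree on overlaps and glue in
    G. *)
Let Q (U : opens X) (s : F U) (r : G U) := forall x, U x ->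
  exists (V : opens X) (h : osub V U), V x /\ P (ps_res h s) (ps_res h r).

Let P_uniq U s r r' : @P U s r -> P s r' -> r = r'.
Proof.
move=> Pr Pr'; apply/eqP; rewrite -subr_eq0; apply/eqP/P_0.
by rewrite -(subrr s); exact: P_sub.
Qed.

Let Q_res (U V : opens X) (h : osub V U) s r : Q s r -> Q (ps_res h s) (ps_res h r).
Proof.
move=> Qr x Vx; have [W [k [Wx Pk]]] := Qr x (h x Vx).
exists (opensI W V), (@osubIr _ W V); split=> //.
rewrite !(ps_res_comp _ _ (osub_trans k (@osubIl _ W V))).
by rewrite -!(ps_res_comp k (@osubIl _ W V)); exact: P_res.
Qed.

Let Q_sub U s r s' r' : @Q U s r -> Q s' r' -> Q (s - s') (r - r').
Proof.
move=> Qr Qr' x Ux; have [V [h [Vx Ph]]] := Qr x Ux.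
have [W [k [Wx Pk]]] := Qr' x Ux.
exists (opensI V W), (osub_trans h (@osubIl _ V W)); split=> //.
rewrite !raddfB; apply: P_sub.
  by rewrite -!(ps_res_comp h (@osubIl _ V W)); exact: P_res.
by rewrite -!(ps_res_comp k (@osubIr _ V W)); exact: P_res.
Qed.

Let Q_uniq U s r r' : @Q U s r -> Q s r' -> r = r'.
Proof.
move=> Qr Qr'; apply: sheaf_ext => x Ux; have [V [h [Vx Ph]]] := Qr x Ux.
have [W [k [Wx Pk]]] := Qr' x Ux.
exists (opensI V W), (osub_trans h (@osubIl _ V W)); split=> //.
apply: (@P_uniq _ (ps_res (osub_trans h (@osubIl _ V W)) s)).
  by rewrite -!(ps_res_comp h (@osubIl _ V W)); exact: P_res.
by rewrite -!(ps_res_comp k (@osubIr _ V W)); exact: P_res.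
Qed.

Let Q_total U s : exists r, @Q U s r.
Proof.
pose V (i : {x | U x}) := projT1 (cid (P_local s (projT2 i))).
pose h (i : {x | U x}) : osub (V i) U :=
  projT1 (cid (projT2 (cid (P_local s (projT2 i))))).
have hP i : V i (projT1 i) /\ exists r, P (ps_res (h i) s) r.
  exact: (projT2 (cid (projT2 (cid (P_local s (projT2 i)))))).
pose r i := projT1 (cid (hP i).2).
have rP i : P (ps_res (h i) s) (r i) := projT2 (cid (hP i).2).
have [|i j W hi hj|t [tE _]] := @sheafP X G U _ V h _ r.
- by move=> x Ux; exists (exist _ x Ux); exact: (hP (exist _ x Ux)).1.
- apply: (@P_uniq _ (ps_res (osub_trans (h i) hi) s)).
    by rewrite -(ps_res_comp (h i) hi); exact: P_res.
  by rewrite -(ps_res_comp (h j) hj); exact: P_res.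
exists t => x Ux; pose i : {x | U x} := exist _ x Ux.
by exists (V i), (h i); rewrite tE; split; [exact: (hP i).1|exact: rP].
Qed.

Let g U s := projT1 (cid (@Q_total U s)).
Let gP U s : Q s (@g U s) := projT2 (cid (@Q_total U s)).

Let g_zmod U : zmod_morphism (@g U).
Proof. by move=> s t; apply: Q_uniq (gP _) _; apply: Q_sub; exact: gP. Qed.

Let g_res (U V : opens X) (h : osub V U) s : ps_res h (g s) = g (ps_res h s).
Proof. by apply: Q_uniq (gP _); apply: Q_res; exact: gP. Qed.

Lemma glue_hom : exists f : ab_hom F G, forall U s r, @P U s r -> f U s = r.
Proof.
exists (@AbHom X F G (fun U => additive_of (@g_zmod U)) g_res) => U s r Pr.
apply: Q_uniq (gP _) _ => x Ux; exists U, (@osub_refl _ U).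
by rewrite !ps_res_id.
Qed.

End GlueHomomorphism.

(** * Image sheaves and extension of maps to an injective sheaf *)

Section ImageSheaf.
Variables (X : topologicalType) (F G : sheaf X) (f : ab_hom F G).

Definition in_image (U : opens X) : {pred G U} := fun t => `[< forall x, U x ->
  exists (V : opens X) (h : osub V U), V x /\ exists s : F V, f V s = ps_res h t >].

Lemma in_image_zmod_closed (U : opens X) : zmod_closed (@in_image U).
Proof.
split=> [|t t' /asboolP tP /asboolP tP']; apply/asboolP => x Ux.
  by exists U, (@osub_refl _ U); split=> //; exists 0; rewrite !raddf0.
have [V [h [Vx [s sE]]]] := tP x Ux; have [W [k [Wx [s' sE']]]] := tP' x Ux.
exists (opensI V W), (osub_trans h (@osubIl _ V W)); split=> //.
exists (ps_res (@osubIl _ V W) s - ps_res (@osubIr _ V W) s').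
rewrite !raddfB /= -!ab_hom_res sE sE'.
rewrite (ps_res_comp h _ (osub_trans h (@osubIl _ V W))).
by rewrite (ps_res_comp k _ (osub_trans h (@osubIl _ V W))).
Qed.

HB.instance Definition _ (U : opens X) :=
  GRing.isZmodClosed.Build (G U) (@in_image U) (@in_image_zmod_closed U).

Record image_sec (U : opens X) := ImageSec {
  image_val : G U;
  image_valP : image_val \in @in_image U }.

HB.instance Definition _ (U : opens X) := [isSub for @image_val U].
HB.instance Definition _ (U : opens X) := [Choice of image_sec U by <:].
HB.instance Definition _ (U : opens X) :=
  [SubChoice_isSubZmodule of image_sec U by <:].

Lemma image_res_subproof (U V : opens X) (h : osub V U) (t : image_sec U) :
  ps_res h (image_val t) \in @in_image V.
Proof.
apply/asboolP => x Vx; have /asboolP /(_ x (h x Vx)) := image_valP t.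
move=> [W [k [Wx [s sE]]]]; exists (opensI W V), (@osubIr _ W V); split=> //.
exists (ps_res (@osubIl _ W V) s); rewrite -ab_hom_res sE.
rewrite (ps_res_comp _ _ (osub_trans k (@osubIl _ W V))).
by rewrite (ps_res_comp _ _ (osub_trans k (@osubIl _ W V))).
Qed.

Definition image_res (U V : opens X) (h : osub V U) (t : image_sec U) :=
  ImageSec (image_res_subproof h t).

Lemma image_res_zmod (U V : opens X) (h : osub V U) : zmod_morphism (image_res h).
Proof. by move=> s t; apply: val_inj; rewrite /= !raddfB. Qed.

Lemma image_res_id (U : opens X) (h : osub U U) t : image_res h t = t.
Proof. by apply: val_inj => /=; exact: ps_res_id. Qed.

Lemma image_res_comp (U V W : opens X) (h : osub V U) (k : osub W V)
  (l : osub W U) t : image_res k (image_res h t) = image_res l t.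
Proof. by apply: val_inj => /=; exact: ps_res_comp. Qed.

Definition image_presheaf : presheaf X :=
  @Presheaf X (fun U => image_sec U) (fun U V h => additive_of (image_res_zmod h))
    image_res_id image_res_comp.

Lemma image_sheaf_axiom : sheaf_axiom (fun U V h => image_res (U := U) (V := V) h).
Proof.
move=> U I V VU cov s sE.
have [|t [tE tU]] := @sheafP X G U I V VU cov (fun i => image_val (s i)).
  by move=> i j W hi hj; exact: (congr1 (@image_val W) (sE i j W hi hj)).
have tP : t \in @in_image U.
  apply/asboolP => x /cov [i Vx]; have /asboolP := image_valP (s i).
  move=> /(_ x Vx) [W [k [Wx [r rE]]]]; exists W, (osub_trans (VU i) k).
  split=> //; exists r; rewrite rE -tE; exact: ps_res_comp.
exists (ImageSec tP); split=> [i|t' t'E]; apply: val_inj => /=; first exact: tE.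
by apply: tU => i; rewrite -t'E.
Qed.

Definition image_sheaf : sheaf X := @Sheaf X image_presheaf image_sheaf_axiom.

Lemma image_val_zmod (U : opens X) : zmod_morphism (@image_val U).
Proof. by []. Qed.

Definition image_incl : ab_hom image_sheaf G :=
  @AbHom X image_sheaf G (fun U => additive_of (@image_val_zmod U)) (fun _ _ _ _ => erefl).

Lemma image_corestrict_subproof (U : opens X) (s : F U) : f U s \in @in_image U.
Proof.
apply/asboolP => x Ux; exists U, (@osub_refl _ U); split=> //.
by exists s; rewrite ps_res_id.
Qed.

End ImageSheaf.

(** The kernel condition makes f factor through the image sheaf of i: the value at [i U s] is f s,
    whatever the choice of s. Injectivity then extends the factor along the inclusion of the image
    in G. *)
Lemma injective_sheaf_extend (X : topologicalType) (I F G : sheaf X)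
    (i : ab_hom F G) (f : ab_hom F I) : injective_sheaf I ->
  (forall U s, i U s = 0 -> f U s = 0) ->
  exists g : ab_hom G I, forall U s, g U (i U s) = f U s.
Proof.
move=> Iinj if0.
pose P U (t : image_sheaf i U) (r : I U) :=
  exists2 s, i U s = image_val t & f U s = r.
have [U V h t r [s st sr]|U t r t' r' [s st sr] [s' st' sr']|U r [s s0 <-]|U t x Ux|g' g'P]
    := @glue_hom X (image_sheaf i) I P.
- by exists (ps_res h s); rewrite -ab_hom_res ?st ?sr.
- by exists (s - s'); rewrite raddfB ?st ?st' ?sr ?sr'.
- exact: if0.
- have /asboolP /(_ x Ux) [V [h [Vx [s sE]]]] := image_valP t.
  by exists V, h; split=> //; exists (f V s), s.
have [|g gE] := Iinj _ _ (image_incl i) g'.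
  by move=> U s t; exact: val_inj.
exists g => U s; have := gE U (ImageSec (image_corestrict_subproof i s)).
by move=> /= ->; apply: g'P; exists s.
Qed.

(** * Comparison of injective resolutions *)

Section Homomorphisms.
Variable X : topologicalType.
Implicit Types F G H : sheaf X.

Lemma comp_hom_res F G H (g : ab_hom G H) (f : ab_hom F G) (U V : opens X)
  (h : osub V U) (s : F U) :
  ps_res h ((g U \o f U) s) = (g V \o f V) (ps_res h s).
Proof. by rewrite /= !ab_hom_res. Qed.

Definition comp_hom F G H (g : ab_hom G H) (f : ab_hom F G) : ab_hom F H :=
  @AbHom X F H (fun U => g U \o f U) (comp_hom_res g f).

Lemma sub_hom_zmod F G (f g : ab_hom F G) U : zmod_morphism (fun s => f U s - g U s).
Proof. by move=> s t; rewrite !raddfB !opprK addrACA. Qed.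

Lemma sub_hom_res F G (f g : ab_hom F G) (U V : opens X) (h : osub V U) (s : F U) :
  ps_res h (f U s - g U s) = f V (ps_res h s) - g V (ps_res h s).
Proof. by rewrite raddfB !ab_hom_res. Qed.

Definition sub_hom F G (f g : ab_hom F G) : ab_hom F G :=
  @AbHom X F G (fun U => additive_of (@sub_hom_zmod F G f g U)) (sub_hom_res f g).

Lemma id_hom_res F (U V : opens X) (h : osub V U) (s : F U) :
  ps_res h ((idfun : {additive F U -> F U}) s) =
  (idfun : {additive F V -> F V}) (ps_res h s).
Proof. by []. Qed.

Definition id_hom F : ab_hom F F := @AbHom X F F (fun U => idfun) (@id_hom_res F).

End Homomorphisms.

Section Comparison.
Variable X : topologicalType.
Implicit Types F G H I K : sheaf X.

Lemma exact_at_comp F G H (f : ab_hom F G) (g : ab_hom G H) U s :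
  exact_at f g -> g U (f U s) = 0.
Proof.
move=> fg; apply/fg => x Ux; exists U, (@osub_refl _ U); split=> //.
by exists s; rewrite ps_res_id.
Qed.

(** A section killed by g comes locally from f, so k kills it locally. *)
Lemma exact_at_vanish F G H K (f : ab_hom F G) (g : ab_hom G H) (k : ab_hom G K) :
  exact_at f g -> (forall U s, k U (f U s) = 0) ->
  forall U t, g U t = 0 -> k U t = 0.
Proof.
move=> fg kf U t /fg ft; apply: sheaf_ext => x /ft [V [h [Vx [s sE]]]].
by exists V, h; split=> //; rewrite ab_hom_res -sE kf raddf0.
Qed.

Lemma exact_at_extend F G H I (f : ab_hom F G) (g : ab_hom G H) (k : ab_hom G I) :
  exact_at f g -> injective_sheaf I -> (forall U s, k U (f U s) = 0) ->
  exists l : ab_hom H I, forall U t, l U (g U t) = k U t.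
Proof.
move=> fg Iinj kf; apply: injective_sheaf_extend => //.
exact: exact_at_vanish fg kf.
Qed.

Variables (F G : sheaf X) (RF : injective_resolution F) (RG : injective_resolution G).

Lemma chain_map_exists (f : ab_hom F G) :
  exists a : forall n, ab_hom (ir_sheaf RF n) (ir_sheaf RG n),
    (forall U s, a 0 U (ir_aug RF U s) = ir_aug RG U (f U s)) /\
    (forall n U t, a n.+1 U (ir_d RF n U t) = ir_d RG n U (a n U t)).
Proof.
(* The recursion carries the property that a sends the kernel of d to the kernel of d, which is what
   extending d a along d requires. *)
pose state n := {a : ab_hom (ir_sheaf RF n) (ir_sheaf RG n) |
  forall U t, ir_d RF n U t = 0 -> ir_d RG n U (a U t) = 0}.
have [a0 a0E] : exists a : ab_hom (ir_sheaf RF 0) (ir_sheaf RG 0),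
    forall U s, a U (ir_aug RF U s) = ir_aug RG U (f U s).
  apply: (injective_sheaf_extend (f := comp_hom (ir_aug RG) f)).
    exact: ir_injective.
  move=> U s e; suff -> : s = 0 by rewrite raddf0.
  by apply: (@ir_mono _ _ RF); rewrite e raddf0.
have a0P U t : ir_d RF 0 U t = 0 -> ir_d RG 0 U (a0 U t) = 0.
  refine (exact_at_vanish (k := comp_hom (ir_d RG 0) a0) (@ir_exact0 _ _ RF) _
    (U := U) (t := t)) => V s /=.
  by rewrite a0E; exact: (exact_at_comp _ (@ir_exact0 _ _ RG)).
have step n (a : state n) : exists b : state n.+1,
    forall U t, sval b U (ir_d RF n U t) = ir_d RG n U (sval a U t).
  case: a => a aP /=.
  have [|b bE] := injective_sheaf_extend (i := ir_d RF n)
    (f := comp_hom (ir_d RG n) a) (@ir_injective _ _ RG n.+1).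
    exact: aP.
  suff bP U t : ir_d RF n.+1 U t = 0 -> ir_d RG n.+1 U (b U t) = 0.
    by exists (exist _ b bP).
  refine (exact_at_vanish (k := comp_hom (ir_d RG n.+1) b) (@ir_exactS _ _ RF n) _
    (U := U) (t := t)) => V s /=.
  by rewrite bE; exact: (exact_at_comp _ (@ir_exactS _ _ RG n)).
pose a := fix a n : state n :=
  if n is n'.+1 then projT1 (cid (step n' (a n'))) else exist _ a0 a0P.
exists (fun n => sval (a n)); split=> // n.
exact: (projT2 (cid (step n (a n)))).
Qed.

Lemma null_homotopy_exists (c : forall n, ab_hom (ir_sheaf RF n) (ir_sheaf RG n)) :
  (forall U s, c 0 U (ir_aug RF U s) = 0) ->
  (forall n U t, c n.+1 U (ir_d RF n U t) = ir_d RG n U (c n U t)) ->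
  exists h : forall n, ab_hom (ir_sheaf RF n.+1) (ir_sheaf RG n),
    (forall U t, c 0 U t = h 0 U (ir_d RF 0 U t)) /\
    (forall n U t, c n.+1 U t =
       ir_d RG n U (h n U t) + h n.+1 U (ir_d RF n.+1 U t)).
Proof.
move=> c0 cS.
(* The invariant d c = d h d makes c - d h in the next degree vanish on the range of d, so that it
   factors through the next differential. *)
pose state n := {h : ab_hom (ir_sheaf RF n.+1) (ir_sheaf RG n) |
  forall U t, ir_d RG n U (c n U t) = ir_d RG n U (h U (ir_d RF n U t))}.
have [h0 h0E] := exact_at_extend (@ir_exact0 _ _ RF) (@ir_injective _ _ RG 0) c0.
have h0P U t : ir_d RG 0 U (c 0 U t) = ir_d RG 0 U (h0 U (ir_d RF 0 U t)).
  by rewrite h0E.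
have step n (h : state n) : exists k : state n.+1, forall U t, c n.+1 U t =
    ir_d RG n U (sval h U t) + sval k U (ir_d RF n.+1 U t).
  case: h => h hP /=.
  have [|k kE] := exact_at_extend (@ir_exactS _ _ RF n) (@ir_injective _ _ RG n.+1)
    (k := sub_hom (c n.+1) (comp_hom (ir_d RG n) h)).
    by move=> U s /=; rewrite cS hP subrr.
  suff kP U t : ir_d RG n.+1 U (c n.+1 U t) =
      ir_d RG n.+1 U (k U (ir_d RF n.+1 U t)).
    by exists (exist _ k kP) => U t; rewrite /= kE /= addrC subrK.
  by rewrite kE /= raddfB /= (exact_at_comp _ (@ir_exactS _ _ RG n)) subr0.
pose h := fix h n : state n :=
  if n is n'.+1 then projT1 (cid (step n' (h n'))) else exist _ h0 h0P.
exists (fun n => sval (h n)); split=> [U t|n]; first by rewrite h0E.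
exact: (projT2 (cid (step n (h n)))).
Qed.

End Comparison.

(** Lift f and g to chain maps a and b. Then id - b a lifts id - g f = 0, hence is null-homotopic,
    and a cocycle z differs from b (a z) by a coboundary. *)
Lemma retract_cohomology_vanishes (X : topologicalType) (F G : sheaf X)
    (f : ab_hom F G) (g : ab_hom G F) (i : int) :
  (forall U s, g U (f U s) = s) ->
  cohomology_vanishes i G -> cohomology_vanishes i F.
Proof.
case: i => [n|//] gf [RG RG0]; have [RF] := injective_resolution_exists F.
exists RF => z; rewrite /cocycle => dz.
have [a [a0 aS]] := chain_map_exists RF RG f.
have [b [b0 bS]] := chain_map_exists RG RF g.
pose c n := sub_hom (id_hom (ir_sheaf RF n)) (comp_hom (b n) (a n)).
have [U s|m U t|h [h0 hS]] := null_homotopy_exists (c := c).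
- by rewrite /= a0 b0 gf subrr.
- by rewrite /= aS bS raddfB.
have /RG0 : ir_d RG n (opensT X) (a n (opensT X) z) = 0 by rewrite -aS dz raddf0.
(* In degree 0 a coboundary is 0, so a z = 0 and the homotopy gives z = 0. In higher degrees a z = d
   t, so z = d (h z + b t). *)
case: n z dz {RG0} => [|n] z dz /= => [az|[t tE]].
  by have := h0 _ z; rewrite /= dz raddf0 az raddf0 subr0.
have := hS n _ z; rewrite /= dz raddf0 addr0 -tE bS => /eqP.
rewrite subr_eq => /eqP ->.
by exists (h n (opensT X) z + b n (opensT X) t); rewrite raddfD.
Qed.

(** * Tensor powers of an invertible sheaf *)

Section TensorBasis.
Variables (R : comPzRingType) (M N : lmodType R) (g : M) (h : N).
Hypotheses (g_inj : injective (fun a : R => a *: g))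
  (h_inj : injective (fun a : R => a *: h))
  (g_gen : forall m : M, exists a, m = a *: g)
  (h_gen : forall n : N, exists a, n = a *: h).

(** The sum v of the products of coordinates is invariant under each generator of [tensor_eq], and
    it recovers the coefficient. *)
Lemma tensor_basis_inj (a b : R) : tens [:: (a *: g, h)] = tens [:: (b *: g, h)] -> a = b.
Proof.
pose c m := projT1 (cid (g_gen m)); have cE m : m = c m *: g := projT2 (cid (g_gen m)).
pose d n := projT1 (cid (h_gen n)); have dE n : n = d n *: h := projT2 (cid (h_gen n)).
have cU e : c (e *: g) = e by apply: g_inj; rewrite /= -cE.
have dU e : d (e *: h) = e by apply: h_inj; rewrite /= -dE.
have cD m m' : c (m + m') = c m + c m' by rewrite {1}(cE m) {1}(cE m') -scalerDl cU.
have dD n n' : d (n + n') = d n + d n' by rewrite {1}(dE n) {1}(dE n') -scalerDl dU.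
have cZ e m : c (e *: m) = e * c m by rewrite {1}(cE m) scalerA cU.
have dZ e n : d (e *: n) = e * d n by rewrite {1}(dE n) scalerA dU.
pose v (s : seq (M * N)) := \sum_(mn <- s) c mn.1 * d mn.2.
have vE s t : tensor_eq s t -> v s = v t.
  elim=> {s t}; rewrite /v.
  - by [].
  - by move=> s t _ ->.
  - by move=> s t r _ -> _ ->.
  - by move=> s s' t t' _ ss' _ tt'; rewrite !big_cat /= ss' tt'.
  - by move=> s t; rewrite !big_cat /= addrC.
  - by move=> n; rewrite big_seq1 big_nil /= -(scale0r g) cU mul0r.
  - by move=> m m' n; rewrite !big_cons big_nil /= !addr0 cD mulrDl.
  - by move=> m n n'; rewrite !big_cons big_nil /= !addr0 dD mulrDr.
  - by move=> e m n; rewrite !big_seq1 /= cZ dZ mulrCA mulrA.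
move=> /(cls_rel (tensor_equiv M N)) /vE; rewrite /v !big_seq1 /= !cU.
by rewrite -(scale1r h) dU !mulr1.
Qed.

Lemma tensor_basis_gen (z : tensor M N) : exists a : R, z = a *: tens [:: (g, h)].
Proof.
elim/tensW: z => s; elim: s => [|[m n] s [b sE]].
  by exists 0; rewrite scale0r.
have [c ->] := g_gen m; have [d ->] := h_gen n.
exists (d * c + b); rewrite -cat1s -tensD sE scalerDl; congr (_ + _).
rewrite tensZ /=; apply: tens_eq; apply: tensor_sym.
by rewrite -scalerA; exact: tensor_Z.
Qed.

End TensorBasis.

Section Bases.
Variable X : ringed_space.

(** A trivialization of M on U, encoded by the section that corresponds to 1. *)
Record basis (M : premod X) (U : opens X) (g : pm_sec M U) : Prop := Basis {
  basis_inj : forall (V : opens X) (h : osub V U),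
    injective (fun a : rs_sec V => a *: pm_res h g);
  basis_gen : forall (V : opens X) (h : osub V U) (s : pm_sec M V),
    exists a : rs_sec V, s = a *: pm_res h g }.

Lemma basis_res (M : premod X) (U V : opens X) (h : osub V U) (g : pm_sec M U) :
  basis g -> basis (pm_res h g).
Proof.
move=> [gi gg]; split=> W k; last first.
  by move=> s; rewrite (pm_res_comp h k (osub_trans h k)).
by rewrite (pm_res_comp h k (osub_trans h k)).
Qed.

Lemma basis_gen0 (M : premod X) (U : opens X) (g s : pm_sec M U) :
  basis g -> exists a, s = a *: g.
Proof.
move=> bg; have [a ->] := basis_gen bg (@osub_refl _ U) s.
by exists a; rewrite pm_res_id.
Qed.

Lemma basis_inj0 (M : premod X) (U : opens X) (g : pm_sec M U) :
  basis g -> injective (fun a => a *: g).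
Proof.
move=> bg a b e; apply: (basis_inj bg (h := @osub_refl _ U)).
by rewrite /= pm_res_id.
Qed.

Lemma invertible_basis (L : smod X) : invertible L -> forall x, exists (U : opens X),
  U x /\ exists g : pm_sec L U, basis g.
Proof.
move=> Linv x; have [U [Ux [e [e_bij eE]]]] := Linv x.
exists U; split=> //; exists (e U (@osub_refl _ U) 1).
have gE V (h : osub V U) (a : rs_sec V) :
    a *: pm_res h (e U (@osub_refl _ U) 1) = e V h a.
  by rewrite (eE _ _ _ h) rmorph1 -linearZ /=; congr (e V h _); exact: mulr1.
split=> V h => [a b|s]; first by rewrite /= !gE; exact: (bij_inj (e_bij V h)).
by have [f _ fK] := e_bij V h; exists (f s); rewrite gE fK.
Qed.

(** Local coefficients agree on overlaps by injectivity and glue in the structure sheaf. Sections of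
    a sheafified tensor product are accessible only locally. *)
Lemma basis_local_gen (M : smod X) (U : opens X) (g : pm_sec M U) :
  (forall (V : opens X) (h : osub V U), injective (fun a : rs_sec V => a *: pm_res h g)) ->
  (forall (V : opens X) (h : osub V U) (s : pm_sec M V) x, V x ->
     exists (W : opens X) (k : osub W V), W x /\
     exists a : rs_sec W, pm_res k s = a *: pm_res (osub_trans h k) g) ->
  basis g.
Proof.
move=> gi gl; split=> // V h s.
pose W (i : {x | V x}) := projT1 (cid (gl V h s _ (projT2 i))).
pose k (i : {x | V x}) : osub (W i) V :=
  projT1 (cid (projT2 (cid (gl V h s _ (projT2 i))))).
have kP i : W i (projT1 i) /\
    exists a : rs_sec (W i), pm_res (k i) s = a *: pm_res (osub_trans h (k i)) g.
  exact: (projT2 (cid (projT2 (cid (gl V h s _ (projT2 i)))))).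
pose a i := projT1 (cid (kP i).2).
have aP i : pm_res (k i) s = a i *: pm_res (osub_trans h (k i)) g.
  exact: (projT2 (cid (kP i).2)).
have [|i j W' hi hj|b [bE _]] := @rs_sheaf X V _ W k _ a.
- by move=> x Vx; exists (exist _ x Vx); exact: (kP (exist _ x Vx)).1.
- apply: (gi _ (osub_trans (osub_trans h (k i)) hi)) => /=.
  rewrite -{1}(pm_res_comp (osub_trans h (k i)) hi) -pm_resZ -aP.
  rewrite -(pm_res_comp (osub_trans h (k j)) hj) -pm_resZ -aP.
  by rewrite !(pm_res_comp _ _ (osub_trans (k i) hi)).
exists b; apply: (sheaf_ext (F := M)) => x Vx; pose i : {x | V x} := exist _ x Vx.
exists (W i), (k i); split; first exact: (kP i).1.
apply: etrans (aP i) _; rewrite -bE -(pm_res_comp h (k i)).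
exact/esym/pm_resZ.
Qed.

End Bases.

(** * The canonical map from a presheaf of modules to its sheafification *)

Section SheafifyGerm.
Variables (X : ringed_space) (P : premod X).

Lemma shf_germ_subproof (U : opens X) (s : pm_sec P U) x : U x ->
  exists (V : opens X) (h : osub V U),
    V x /\ germ_class P V (fun y Vy => germ (F := P) (h y Vy) s).
Proof.
by move=> Ux; exists U, (@osub_refl _ U); split=> //; exists s.
Qed.

Definition shf_germ (U : opens X) (s : pm_sec P U) : pm_sec (sheafify P) U :=
  LocFun (fun x Ux => germ (F := P) Ux s) (shf_germ_subproof s).

Lemma shf_germZ (U : opens X) (a : rs_sec U) (s : pm_sec P U) :
  shf_germ (a *: s) = a *: shf_germ s.
Proof.
apply: locfun_ext => x Ux; apply/esym.
apply: etrans (stalk_scaleE a Ux (@osub_refl _ U) Ux s) _.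
by rewrite rs_res_id.
Qed.

Lemma shf_germ_res (U V : opens X) (h : osub V U) (s : pm_sec P U) :
  pm_res h (shf_germ s) = shf_germ (pm_res h s).
Proof. apply: locfun_ext => x Vx; exact/esym/(germ_res (F := P)). Qed.

Lemma shf_germ_inj_local (U : opens X) (s t : pm_sec P U) :
  shf_germ s = shf_germ t -> forall x, U x ->
  exists (V : opens X) (h : osub V U), V x /\ pm_res h s = pm_res h t.
Proof.
move=> e x Ux.
have /germ_eqP [V [h [k [Vx E]]]] := congr1 (fun f : shf_sec P U => f x Ux) e.
by exists V, h; split=> //; rewrite -(Prop_irrelevance h k) in E.
Qed.

Lemma shf_germ_local (U : opens X) (f : pm_sec (sheafify P) U) x : U x ->
  exists (V : opens X) (h : osub V U), V x /\
  exists s : pm_sec P V, pm_res h f = shf_germ s.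
Proof.
move=> Ux; have [V [h [Vx [s sE]]]] := locfunP (f : shf_sec P U) Ux.
exists V, h; split=> //; exists s; apply: locfun_ext => y Vy; exact: sE.
Qed.

End SheafifyGerm.

Section SheafTensorSections.
Variables (X : ringed_space) (M N : smod X).
Implicit Types U V : opens X.

Definition tensor_sec U (m : pm_sec M U) (n : pm_sec N U) :
    pm_sec (sheaf_tensor M N) U :=
  shf_germ (P := presheaf_tensor M N) (tens [:: (m, n)]).

Lemma tensor_secZ U (a b : rs_sec U) (m : pm_sec M U) (n : pm_sec N U) :
  tensor_sec (a *: m) (b *: n) = (a * b) *: tensor_sec m n.
Proof.
rewrite /tensor_sec -shf_germZ; congr shf_germ.
rewrite [RHS]tensZ /= mulrC -scalerA.
exact/tens_eq/tensor_sym/tensor_Z.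
Qed.

Lemma tensor_sec_res U V (h : osub V U) (m : pm_sec M U) (n : pm_sec N U) :
  pm_res h (tensor_sec m n) = tensor_sec (pm_res h m) (pm_res h n).
Proof. by rewrite [LHS]shf_germ_res; congr shf_germ; exact: ptens_resE. Qed.

(** Locally, sections of the sheafification and equalities between them come from the presheaf
    tensor product, where the module statements on tensors of bases apply. *)
Lemma tensor_sec_basis U (g : pm_sec M U) (h : pm_sec N U) :
  basis g -> basis h -> basis (tensor_sec g h).
Proof.
move=> bg bh; apply: basis_local_gen => [V k a b|V k s x Vx].
  rewrite /= tensor_sec_res -!shf_germZ => /shf_germ_inj_local ab.
  apply: (sheaf_axiom_ext (@rs_res_comp X) (@rs_sheaf X)) => x /ab [W [l [Wx e]]].
  exists W, l; split=> //; move: e; rewrite !pm_resZ /= !ptens_resE !tensZ /=.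
  rewrite !(pm_res_comp _ _ (osub_trans k l)).
  by apply: tensor_basis_inj;
    [exact: basis_inj|exact: basis_inj|exact: basis_gen|exact: basis_gen].
have [W [l [Wx [z zE]]]] := shf_germ_local s Vx.
exists W, l; split=> //.
have [a aE] : exists a : rs_sec W, z = a *: tens [::
    (pm_res (osub_trans k l) g, pm_res (osub_trans k l) h)].
  apply: tensor_basis_gen; exact: basis_gen.
by exists a; rewrite tensor_sec_res zE aE shf_germZ.
Qed.

End SheafTensorSections.

Section TensorPowerSections.
Variables (X : ringed_space) (L : smod X).
Implicit Types U V : opens X.

Fixpoint power_sec n U (s : pm_sec L U) : pm_sec (tensor_power L n) U :=
  if n is n'.+1 then tensor_sec (power_sec n' s) s else (1 : rs_sec U).

Lemma power_secZ n U (a : rs_sec U) (s : pm_sec L U) :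
  power_sec n (a *: s) = a ^+ n *: power_sec n s.
Proof.
elim: n => [|n IHn] /=; first by rewrite scale1r.
by rewrite IHn tensor_secZ exprSr.
Qed.

Lemma power_sec_res n U V (h : osub V U) (s : pm_sec L U) :
  pm_res h (power_sec n s) = power_sec n (pm_res h s).
Proof.
elim: n => [|n IHn]; first exact: rmorph1.
by rewrite /= [LHS]tensor_sec_res IHn.
Qed.

Lemma power_sec_basis n U (g : pm_sec L U) : basis g -> basis (power_sec n g).
Proof.
move=> bg; elim: n => [|n IHn]; last exact: tensor_sec_basis.
have E V (h : osub V U) (a : rs_sec V) : a *: pm_res h (power_sec 0 g) = a.
  by rewrite [pm_res _ _]rmorph1; exact: mulr1.
split=> V h => [a b|s]; first by rewrite /= !E.
by exists s; rewrite E.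
Qed.

End TensorPowerSections.

(** * The splitting of L -> L^(p^n) *)

Section FrobeniusSplitting.
Variables (X : ringed_space) (p : nat) (Xp : has_char X p).
Implicit Types U V : opens X.

Lemma char_exprXB (R : comPzRingType) (Rp : ring_char R p) n (a b : R) :
  (a - b) ^+ (p ^ n) = a ^+ (p ^ n) - b ^+ (p ^ n).
Proof.
apply/eqP; rewrite eq_sym subr_eq; apply/eqP; rewrite -{1}(subrK b a).
move: (a - b) => c {a}; elim: n c b => [|n IHn] c b; first by rewrite !expn0 !expr1.
by rewrite expnS !exprM (char_exprD Rp) IHn.
Qed.

(** Induct with [phi] after [psi]: since a^(p^(n+1)) = (a^p)^(p^n), [psi] extracts a^p, and the
    linearity of [phi] for the Frobenius module turns it into a. *)
Lemma frobenius_split_iter : frobenius_split Xp -> forall n,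
  exists psi : forall U, {additive rs_sec U -> rs_sec U},
    [/\ forall U V (h : osub V U) a, rs_res h (psi U a) = psi V (rs_res h a),
        forall U a b, psi U (a ^+ (p ^ n) * b) = a * psi U b &
        forall U, psi U 1 = 1].
Proof.
move=> [phi phiK]; elim=> [|n [psi [psi_res psiM psi1]]].
  by exists (fun U => idfun).
pose phiA U := additive_of (raddfB (phi U) : zmod_morphism (phi U : rs_sec U -> rs_sec U)).
exists (fun U => phiA U \o psi U); split=> [U V h a|U a b|U] /=.
- by rewrite -psi_res; exact: (mhom_res phi h (psi U a)).
- rewrite expnS exprM psiM; exact: (linearZZ (phi U) a (psi U b)).
- by rewrite psi1; have := phiK U 1; rewrite /= /frob expr1n.
Qed.

Variables (L : smod X) (Linv : invertible L) (n : nat).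
Local Notation q := (p ^ n)%N.

Lemma power_sec_zmod U : zmod_morphism (@power_sec X L q U).
Proof.
move=> s t; apply: (sheaf_ext (F := tensor_power L q)) => x Ux.
have [V [Vx [g bg]]] := invertible_basis Linv x.
exists (opensI U V), (@osubIl _ U V); split=> //.
have [a aE] := basis_gen bg (@osubIr _ U V) (pm_res (@osubIl _ U V) s).
have [b bE] := basis_gen bg (@osubIr _ U V) (pm_res (@osubIl _ U V) t).
rewrite [RHS]raddfB -[LHS]/(pm_res _ _) -!/(pm_res _ _) !power_sec_res.
rewrite raddfB aE bE -scalerBl !power_secZ -scalerBl; congr (_ *: _).
exact: char_exprXB.
Qed.

Definition power_hom : ab_hom L (tensor_power L q) :=
  @AbHom X L (tensor_power L q) (fun U => additive_of (@power_sec_zmod U))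
    (fun U V h s => power_sec_res q h s).

(* If g' = u g and a' g'^q = a g^q, then a = a' u^q and psi a' g' = psi a g, so
   a g^q |-> psi a g does not depend on the basis g. *)
Lemma power_hom_retraction : frobenius_split Xp ->
  exists r : ab_hom (tensor_power L q) L, forall U s, r U (power_hom U s) = s.
Proof.
move=> /frobenius_split_iter /(_ n) [psi [psi_res psiM psi1]].
pose P U (t : pm_sec (tensor_power L q) U) (r : pm_sec L U) :=
  exists2 g, basis g & exists2 a, t = a *: power_sec q g & r = psi U a *: g.
have [U V h t r [g bg [a -> ->]]|U t r t' r' [g bg [a -> ->]] [g' bg' [a' -> ->]]
     |U r [g bg [a a0 ->]]|U t x Ux|r rP] := @glue_hom X (tensor_power L q) L P.
- exists (pm_res h g); first exact: basis_res.
  exists (rs_res h a); first by rewrite -power_sec_res; exact: pm_resZ.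
  by rewrite -psi_res; exact: pm_resZ.
(* Writing g' = u g puts both sections in the basis g, and psi (a' u^q) = u psi a' matches the
   values. *)
- have [u ->] := basis_gen0 g' bg; exists g => //.
  exists (a - a' * u ^+ q); first by rewrite power_secZ scalerA scalerBl.
  by rewrite raddfB scalerBl scalerA (mulrC a') psiM (mulrC u).
- suff -> : a = 0 by rewrite raddf0 scale0r.
  by apply: (basis_inj0 (power_sec_basis q bg)); rewrite /= scale0r.
- have [V [Vx [g bg]]] := invertible_basis Linv x.
  exists (opensI U V), (@osubIl _ U V); split=> //.
  have bg' := basis_res (@osubIr _ U V) bg.
  have [a aE] := basis_gen0 (pm_res (@osubIl _ U V) t) (power_sec_basis q bg').
  exists (psi _ a *: pm_res (@osubIr _ U V) g), (pm_res (@osubIr _ U V) g) => //.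
  by exists a.
exists r => U s; apply: (sheaf_ext (F := L)) => x Ux.
have [V [Vx [g bg]]] := invertible_basis Linv x.
exists (opensI U V), (@osubIl _ U V); split=> //.
rewrite !ab_hom_res; apply: rP.
have [a aE] := basis_gen bg (@osubIr _ U V) (pm_res (@osubIl _ U V) s).
exists (pm_res (@osubIr _ U V) g); first exact: basis_res.
(* For s = a g the q-th power is a^q g^q, and psi (a^q) = a psi 1 = a. *)
exists (a ^+ q); first by rewrite -power_secZ -aE.
by rewrite -[a ^+ q]mulr1 psiM psi1 mulr1.
Qed.

End FrobeniusSplitting.

Theorem theorem2p3 (X : scheme) (p : nat) (Xp : has_char X p)
    (split : frobenius_split Xp) (L : smod X) (Linv : invertible L) (i : int) :
  (exists N : nat, forall n : nat, (N <= n)%N ->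
     cohomology_vanishes i (tensor_power L n)) ->
  cohomology_vanishes i L.
Proof.
move=> [N HN].
(* The exponent N itself suffices: p is at least 2, so N < p^N. *)
have [r rK] := power_hom_retraction Linv N split.
apply: (@retract_cohomology_vanishes X L (tensor_power L (p ^ N)) _ r i rK).
apply: HN.
have [p_pr _] := Xp (opensT X).
exact: ltnW (ltn_expl N (prime_gt1 p_pr)).
Qed.
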